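(* Let $F$ be a strongly symmetric norm on $\mathbb{R}^2$. There exists a singularization area $\mathcal S$ such that, for every irrational $\alpha$, the $F$-continued fraction of $\alpha$ is the $\mathcal S$-expansion of $\alpha$.
   Context: A norm $F$ on $\mathbb{R}^2$ is strongly symmetric if $F(x,y)=F(|x|,|y|)$ and $F(0,\pm1)=F(\pm1,0)=1$; $F_t(x,y)=F(t^{-1}x,ty)$ for $t>0$. A semi-regular continued fraction is $a_0+\frac{\varepsilon_1}{a_1+}\frac{\varepsilon_2}{a_2+}\cdots$ with $a_0\in\mathbb{Z}$, integers $a_m>0$, $\varepsilon_m=\pm1$, $a_m+\varepsilon_{m+1}\ge1$ for all $m\ge1$ and $a_m+\varepsilon_{m+1}\ge2$ for infinitely many $m$; its convergents are $a_0+\frac{\varepsilon_1}{a_1+}\cdots\frac{\varepsilon_m}{a_m}$. A rational $\frac pq$ ($q>0$) is a best approximation to $\alpha$ w.r.t. $F$ if for some $t>1$, $F_t(q,p-\alpha q)<F_t(s,r-\alpha s)$ for all rationals $\frac rs\ne\frac pq$. The $F$-continued fraction of an irrational $\alpha$ is the unique semi-regular continued fraction converging to $\alpha$ whose convergents are exactly the best approximations to $\alpha$ w.r.t. $F$. Let $\Omega_0=[0,1)\times[0,1]$, $T:\Omega_0\to\Omega_0$ with $T(0,v)=(0,0)$ and $T(u,v)=\left(\frac1u-\lfloor\frac1u\rfloor,\frac{1}{v+\lfloor 1/u\rfloor}\right)$ for $u>0$, and $\omega$ the measure on $\Omega_0$ with density $\frac{1}{\log 2}\frac{1}{(1+uv)^2}$.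 A Borel set $\mathcal S\subset\Omega_0$ is a singularization area if $\omega(\partial\mathcal S)=0$, $\mathcal S\subseteq[\frac12,1)\times[0,1]$, and $T\mathcal S\cap\mathcal S\subseteq\{(\beta,\beta)\}$ with $\beta=\frac12(-1+\sqrt5)$. For irrational $\alpha$ with regular continued fraction $\alpha=b_0+\frac{1}{b_1+}\frac{1}{b_2+}\cdots$ ($b_0=\lfloor\alpha\rfloor$, $b_k\ge1$) and regular convergents $\frac{r_n}{s_n}$, set $u_0=\alpha-b_0$, $v_0=0$ and for $n\ge1$, $u_n=\frac{1}{b_{n+1}+}\frac{1}{b_{n+2}+}\cdots$, $v_n=\frac{1}{b_n+}\frac{1}{b_{n-1}+}\cdots\frac{1}{b_1}$. The $\mathcal S$-expansion of $\alpha$ is obtained from the regular continued fraction by, for each $n$ with $(u_n,v_n)\in\mathcal S$ (which forces $b_{n+1}=1$), replacing $\cdots\frac{1}{b_n+}\frac{1}{1+}\frac{1}{b_{n+2}+}\cdots$ by $\cdots\frac{1}{(b_n+1)+}\frac{-1}{(b_{n+2}+1)+}\cdots$ (for $n=0$: replacing $b_0+\frac{1}{1+}\frac{1}{b_2+}\cdots$ by $(b_0+1)+\frac{-1}{(b_2+1)+}\cdots$); it is the unique semi-regular continued fraction of $\alpha$ whose convergents are exactly the $\frac{r_n}{s_n}$ with $(u_n,v_n)\notin\mathcal S$. *)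

(* Defs.v *)
From HB Require Import structures.
From mathcomp Require Export all_boot all_order all_algebra.
From mathcomp Require Export all_classical all_reals all_analysis.

Set Implicit Arguments.
Unset Strict Implicit.
Unset Printing Implicit Defensive.

Import Order.TTheory GRing.Theory Num.Theory.
Import numFieldNormedType.Exports.

Local Open Scope classical_set_scope.
Local Open Scope ring_scope.

Section Norms.
Context {R : realType}.
Implicit Types (F : R * R -> R) (alpha : R).

Definition is_norm F : Prop :=
  [/\ forall x y x' y' : R, F (x + x', y + y') <= F (x, y) + F (x', y'),
      forall c x y : R, F (c * x, c * y) = `|c| * F (x, y)
    & forall x y : R, F (x, y) = 0 -> x = 0 /\ y = 0].

Definition strongly_symmetric F : Prop :=
  (forall x y : R, F (x, y) = F (`|x|, `|y|)) /\
  [/\ F (0, 1) = 1, F (0, -1) = 1, F (1, 0) = 1 & F (-1, 0) = 1].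

Definition rescale F (t : R) : R * R -> R :=
  fun z => F (t^-1 * z.1, t * z.2).

(* For x = p/q in lowest terms with q > 0, the vector (q, p - alpha q). *)
Definition approx_vec alpha (x : rat) : R * R :=
  ((denq x)%:~R, (numq x)%:~R - alpha * (denq x)%:~R).

Definition best_approximation F alpha (x : rat) : Prop :=
  exists2 t : R, 1 < t &
    forall y : rat, y != x ->
      rescale F t (approx_vec alpha x) < rescale F t (approx_vec alpha y).

End Norms.

(* A continued fraction a_0 + eps_1/(a_1 + eps_2/(a_2 + ...)) is given by two
   sequences a, eps : nat -> int; the value eps 0 is never used. *)

Section ContinuedFractions.
Implicit Types (a eps b : nat -> int).

(* cf_segment a eps k m is
     a_k + eps_(k+1)/(a_(k+1) + ... + eps_(k+m)/a_(k+m)).  *)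
Fixpoint cf_segment a eps (k m : nat) : rat :=
  if m is m'.+1 then
    (a k)%:~R + (eps k.+1)%:~R / cf_segment a eps k.+1 m'
  else (a k)%:~R.

Definition convergent a eps (m : nat) : rat := cf_segment a eps 0 m.

Definition same_cf a eps a' eps' : Prop :=
  (forall m, a m = a' m) /\ (forall m, (0 < m)%N -> eps m = eps' m).

Definition semi_regular a eps : Prop :=
  [/\ forall m, (0 < m)%N -> 0 < a m,
      forall m, (0 < m)%N -> eps m = 1 \/ eps m = -1,
      forall m, (0 < m)%N -> 1 <= a m + eps m.+1
    & forall N : nat, exists2 m, (N < m)%N & 2 <= a m + eps m.+1].

Context {R : realType}.
Implicit Types (alpha : R).

Definition cf_converges a eps alpha : Prop :=
  (ratr (convergent a eps m) : R) @[m --> \oo] --> alpha.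

Definition has_F_convergents (F : R * R -> R) alpha a eps : Prop :=
  [/\ semi_regular a eps,
      cf_converges a eps alpha
    & forall x : rat,
        best_approximation F alpha x <-> exists m, convergent a eps m = x].

Definition is_F_continued_fraction (F : R * R -> R) alpha a eps : Prop :=
  has_F_convergents F alpha a eps /\
  forall a' eps', has_F_convergents F alpha a' eps' -> same_cf a eps a' eps'.

Definition is_regular_cf alpha b : Prop :=
  [/\ b 0%N = Num.floor alpha,
      forall k, (0 < k)%N -> 1 <= b k
    & cf_converges b (fun=> 1) alpha].

(* u_n = 1/(b_(n+1) + 1/(b_(n+2) + ...)) for n >= 1, an infinite continued
   fraction, hence the limit of its finite truncations. *)
Definition rcf_u alpha b (n : nat) : R :=
  if n is 0%N then alpha - (b 0%N)%:~R
  else lim ((ratr (cf_segment b (fun=> 1) n.+1 m) : R)^-1 @[m --> \oo]).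

(* v_n = 1/(b_n + 1/(b_(n-1) + ... + 1/b_1)). *)
Fixpoint rcf_v b (n : nat) : R :=
  if n is n'.+1 then ((b n)%:~R + rcf_v b n')^-1 else 0.

End ContinuedFractions.

Section Singularization.
Context {R : realType}.
Implicit Types (S : set (R * R)) (alpha : R) (a eps b : nat -> int).

Definition Omega0 : set (R * R) := `[0, 1[ `*` `[0, 1].

Definition natural_extension (z : R * R) : R * R :=
  if z.1 == 0 then (0, 0)
  else (z.1^-1 - (Num.floor z.1^-1)%:~R, (z.2 + (Num.floor z.1^-1)%:~R)^-1).

(* omega is extended by 0 outside Omega0. *)
Definition omega (A : set (R * R)) : \bar R :=
  (\int[lebesgue_measure \x lebesgue_measure]_(z in A `&` Omega0)
     ((ln 2)^-1 * ((1 + z.1 * z.2) ^+ 2)^-1)%:E)%E.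

(* Taking the boundary in R^2 or relative to Omega0 makes no difference below:
   the two differ only on the sides of the square, which are omega-null. *)
Definition boundary (A : set (R * R)) : set (R * R) := closure A `\` interior A.

Definition beta : R := 2^-1 * (-1 + Num.sqrt 5).

Definition singularization_area S : Prop :=
  [/\ <<s @open (R * R)%type >> S,
      S `<=` Omega0,
      omega (boundary S) = 0%E,
      S `<=` `[2^-1, 1[ `*` `[0, 1]
    & (natural_extension @` S) `&` S `<=` [set (beta, beta)]].

Definition singularized S alpha b (n : nat) : bool :=
  `[< S (rcf_u alpha b n, rcf_v b n) >].

(* Simultaneous replacement, for every singularized n, of
     b_n + 1/(1 + 1/(b_(n+2) + ...))  by  (b_n + 1) - 1/((b_(n+2) + 1) + ...) :
   the term b_(n+1) is deleted, b_n and b_(n+2) are increased by 1, and the sign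
   in front of b_(n+2) becomes -1.  Here k enumerates in increasing order the
   indices of the terms of the regular continued fraction that are kept. *)
Definition is_S_expansion S alpha a eps : Prop :=
  exists b, is_regular_cf alpha b /\
  let sing := singularized S alpha b in
  let sing2 j := (2 <= j)%N && sing (j - 2)%N in
  exists k : nat -> nat,
    [/\ forall m, (k m < k m.+1)%N,
        forall j, (exists m, k m = j) <-> (j = 0%N \/ ~~ sing j.-1),
        forall m, a m = b (k m) + (sing (k m))%:R + (sing2 (k m))%:R
      & forall m, (0 < m)%N -> eps m = if sing2 (k m) then -1 else 1].

End Singularization.

(* Main.v *)
Require Import Defs.
From mathcomp Require Import measurable_realfun.
From mathcomp Require Import ring lra zify.

Set Implicit Arguments.
Unset Strict Implicit.
Unset Printing Implicit Defensive.

Import Order.TTheory GRing.Theory Num.Theory.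
Import numFieldNormedType.Exports.

Local Open Scope classical_set_scope.
Local Open Scope ring_scope.

(** Write e_n = (s_n, r_n - alpha s_n) for the vector of the n-th regular
    convergent.  Up to signs and a common rescaling, e_(n-1), e_n, e_(n+1) are
    (v_n, t), (1, t u_n), (1 + v_n, t (1 - u_n)) when b_(n+1) = 1, the parameter
    t > 0 recording the scaling of the norm.  The area S consists of the (u, v)
    with 1/2 < u < 1 for which the middle vector is, for no t, strictly shorter
    than both others.

    Two facts on F drive the proof.  Crossing: if q1 < p1 and p2 < q2, then
    F(p1, t p2) <= F(q1, t q2) propagates, strictly, to all larger t.  Strict
    triangle inequality: F(z + z') < 2 m if F(z), F(z') <= m and the segment
    from z to z' crosses an axis, because F(x, 0) = |x| and F(0, y) = |y|.

    - S is closed in the strip 1/2 < u < 1, and a point of a vertical section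
      strictly below another one is interior, so the boundary meets every
      vertical line u <> 1/2 in a countable set.
    - If e_n and e_(n+1) were both in the shadow, then at the t where
      F(e_(n-1)) = F(e_(n+2)) both would be strictly shorter than this common
      value, hence of equal length for all nearby t, against crossing.
    - A best approximation is a regular convergent by the classical law of best
      approximation, and a convergent in S is beaten by a neighbour.
    - Outside S, if e_n were never the strict minimum, continuity would give t and
      two lattice vectors e_(n-1) + i e_n and e_(n-1) + j e_n with j - i >= 2 that
      are not longer than e_n; their difference is (j - i) e_n.
    - A semi-regular continued fraction has strictly decreasing errors
      |p_m - alpha q_m|, so it is determined by its set of convergents. *)

(** * Strongly symmetric norms *)

Section SymmetricNorm.
Context {R : realType}.
Implicit Types (F : R * R -> R) (x y m : R).

(** Exchanging the coordinates preserves all hypotheses on the norm, so an estimate proved for one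
    coordinate transfers to the other. *)
Definition swap_norm F : R * R -> R := fun z => F (z.2, z.1).

Lemma is_norm_swap F : is_norm F -> is_norm (swap_norm F).
Proof.
move=> [tri hom def]; split => [x y x' y'|c x y|x y] /=.
- exact: tri.
- exact: hom.
- by move=> /def[].
Qed.

Lemma strongly_symmetric_swap F :
  strongly_symmetric F -> strongly_symmetric (swap_norm F).
Proof. by move=> [sym [? ? ? ?]]; split => // x y; exact: sym. Qed.

Section Basic.
Context (F : R * R -> R) (Fnorm : is_norm F) (Fsym : strongly_symmetric F).

Lemma norm_scale c x y : F (c * x, c * y) = `|c| * F (x, y).
Proof. by case: Fnorm. Qed.

Lemma norm_pscale c x y : 0 <= c -> F (c * x, c * y) = c * F (x, y).
Proof. by move=> c0; rewrite norm_scale ger0_norm. Qed.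

Lemma norm_triangle x y x' y' : F (x + x', y + y') <= F (x, y) + F (x', y').
Proof. by case: Fnorm. Qed.

Lemma norm_abs x y : F (x, y) = F (`|x|, `|y|).
Proof. by case: Fsym. Qed.

Lemma norm_Nl x y : F (- x, y) = F (x, y).
Proof. by rewrite (norm_abs (- x)) normrN -norm_abs. Qed.

Lemma norm_Nr x y : F (x, - y) = F (x, y).
Proof. by rewrite (norm_abs x (- y)) normrN -norm_abs. Qed.

Lemma norm_x0 x : F (x, 0) = `|x|.
Proof.
have [_ [_ _ F10 _]] := Fsym.
by have := norm_scale x 1 0; rewrite mulr1 mulr0 F10 mulr1.
Qed.

Lemma norm_0y y : F (0, y) = `|y|.
Proof.
have [_ [F01 _ _ _]] := Fsym.
by have := norm_scale y 0 1; rewrite mulr1 mulr0 F01 mulr1.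
Qed.

Lemma norm_cone a b x y x' y' : 0 <= a -> 0 <= b ->
  F (a * x + b * x', a * y + b * y') <= a * F (x, y) + b * F (x', y').
Proof.
by move=> a0 b0; rewrite (le_trans (norm_triangle _ _ _ _))// !norm_pscale.
Qed.

(** The point [(x, y)] is a convex combination of [(x', y)] and [(- x', y)], which have the same
    norm by symmetry. *)
Lemma norm_le_l x x' y : 0 <= x -> x <= x' -> F (x, y) <= F (x', y).
Proof.
move=> x0 xx'; have [->//|ne] := eqVneq x x'.
have x'0 : 0 < x' by rewrite (le_lt_trans x0)// lt_neqAle ne.
have q1 : x / x' <= 1 by rewrite ler_pdivrMr// mul1r.
have q0 : 0 <= x / x' by rewrite divr_ge0// ltW.
have := @norm_cone ((1 + x / x') / 2) ((1 - x / x') / 2) x' y (- x') y.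
rewrite norm_Nl.
have -> : (1 + x / x') / 2 * x' + (1 - x / x') / 2 * - x' = x.
  by field; rewrite gt_eqF.
have eN z : (1 + x / x') / 2 * z + (1 - x / x') / 2 * z = z.
  by field; rewrite gt_eqF.
by rewrite !eN; apply; rewrite divr_ge0//; lra.
Qed.

End Basic.

Section Order.
Context (F : R * R -> R) (Fnorm : is_norm F) (Fsym : strongly_symmetric F).

Lemma norm_le_r x y y' : 0 <= y -> y <= y' -> F (x, y) <= F (x, y').
Proof.
move=> y0 yy'.
exact: (norm_le_l (is_norm_swap Fnorm) (strongly_symmetric_swap Fsym) x y0 yy').
Qed.

Lemma norm_le x y x' y' : `|x| <= `|x'| -> `|y| <= `|y'| ->
  F (x, y) <= F (x', y').
Proof.
move=> xx' yy'; rewrite (norm_abs Fsym x) (norm_abs Fsym x').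
by rewrite (le_trans (norm_le_l Fnorm Fsym _ _ xx'))// norm_le_r.
Qed.

Lemma norm_ge_l x y : `|x| <= F (x, y).
Proof. by rewrite -(norm_x0 Fnorm Fsym) norm_le// normr0. Qed.

Lemma norm_ge_r x y : `|y| <= F (x, y).
Proof. by rewrite -(norm_0y Fnorm Fsym) norm_le// normr0. Qed.

Lemma norm_le_sum x y : F (x, y) <= `|x| + `|y|.
Proof.
have := norm_triangle Fnorm x 0 0 y.
by rewrite addr0 add0r (norm_x0 Fnorm Fsym) (norm_0y Fnorm Fsym).
Qed.

Lemma norm_lt x y x' y' : `|x| < `|x'| -> `|y| < `|y'| -> F (x, y) < F (x', y').
Proof.
move=> xx' yy'.
have x'0 : 0 < `|x'| by apply: le_lt_trans xx'.
have y'0 : 0 < `|y'| by apply: le_lt_trans yy'.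
pose c := Num.max (`|x| / `|x'|) (`|y| / `|y'|).
have c1 : c < 1 by rewrite /c gt_max !ltr_pdivrMr// !mul1r xx'.
have c0 : 0 <= c by rewrite le_max divr_ge0.
apply: (@le_lt_trans _ _ (F (c * x', c * y'))).
  by apply: norm_le; rewrite normrM (ger0_norm c0) -ler_pdivrMr// le_max lexx ?orbT.
rewrite norm_pscale// gtr_pMl//.
by apply: lt_le_trans (norm_ge_l _ _).
Qed.

(** The point [(x, y)] lies on the segment from [(x, 0)], of norm |x|, to [(x, y')]. By convexity,
    the norm can fail to increase along a vertical ray only while it equals |x|. *)
Lemma norm_flat_r x y y' : 0 <= y -> y < y' -> F (x, y') <= F (x, y) ->
  F (x, y') <= `|x|.
Proof.
move=> y0 yy' le.
have y'0 : 0 < y' by apply: le_lt_trans yy'.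
have q1 : y / y' < 1 by rewrite ltr_pdivrMr// mul1r.
have := @norm_cone F Fnorm (1 - y / y') (y / y') x 0 x y'.
rewrite mulr0 add0r divfK ?gt_eqF// -mulrDl subrK mul1r.
rewrite subr_ge0 (ltW q1) divr_ge0 ?(ltW y'0)// (norm_x0 Fnorm Fsym).
move=> /(_ isT isT) h; nra.
Qed.

Lemma norm_dist x y x' y' :
  `|F (x, y) - F (x', y')| <= `|x - x'| + `|y - y'|.
Proof.
have h a b a' b' : F (a, b) - F (a', b') <= `|a - a'| + `|b - b'|.
  have := norm_triangle Fnorm (a - a') (b - b') a' b'; rewrite !subrK => h.
  have := norm_le_sum (a - a') (b - b'); lra.
rewrite ler_norml h andbT.
by have := h x' y' x y; rewrite distrC (distrC y); lra.
Qed.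

Lemma norm_continuous : continuous F.
Proof.
move=> [x y]; apply/cvgrPdist_lt => e e0.
have e20 : 0 < e / 2 by rewrite divr_gt0.
exists (ball x (e / 2), ball y (e / 2)) => /=.
  by split; apply/nbhs_ballP; exists (e / 2).
move=> [x' y'] [/= xx' yy']; rewrite (le_lt_trans (norm_dist _ _ _ _))//.
by rewrite (splitr e) ltrD.
Qed.

End Order.

Lemma norm_flat_l F x x' y : is_norm F -> strongly_symmetric F ->
  0 <= x -> x < x' -> F (x', y) <= F (x, y) -> F (x', y) <= `|y|.
Proof.
move=> Fnorm Fsym.
exact: (norm_flat_r (is_norm_swap Fnorm) (strongly_symmetric_swap Fsym)).
Qed.

Section Crossing.
Context (F : R * R -> R) (Fnorm : is_norm F) (Fsym : strongly_symmetric F).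

(* In angular order, (q1, q2) and (p1, l p2) lie between (p1, p2) and
   (q1, l q2), so both are nonnegative combinations of these two vectors. *)
Lemma norm_cross p1 p2 q1 q2 l : 0 <= q1 -> q1 < p1 -> 0 <= p2 -> p2 < q2 ->
  1 < l -> F (p1, p2) <= F (q1, q2) -> F (p1, l * p2) < F (q1, l * q2).
Proof.
move=> q10 qp1 p20 pq2 l1 le; rewrite ltNge; apply/negP => le'.
(* [D] is the determinant of [(p1, p2)] and [(q1, l * q2)]; the coefficients below come from
   Cramer's rule. *)
pose D := l * p1 * q2 - p2 * q1.
have D0 : 0 < D.
  have : p2 * q1 <= q2 * p1 by rewrite ler_pM// ltW.
  have : 0 < q2 * p1 by rewrite mulr_gt0//; lra.
  rewrite /D; nra.
have Dn0 : D != 0 by rewrite gt_eqF.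
have detn : 0 < p1 * q2 - p2 * q1 by nra.
have a0 : 0 <= q1 * q2 * (l - 1) / D by rewrite divr_ge0 ?(ltW D0)// !mulr_ge0//; lra.
have b0 : 0 <= (p1 * q2 - p2 * q1) / D by rewrite divr_ge0// ltW.
have c0 : 0 <= l * (p1 * q2 - p2 * q1) / D.
  by rewrite divr_ge0 ?(ltW D0)// mulr_ge0//; lra.
have d0 : 0 <= (l - 1) * p1 * p2 / D.
  by rewrite divr_ge0 ?(ltW D0)// !mulr_ge0//; lra.
have h1 := norm_cone Fnorm p1 p2 q1 (l * q2) a0 b0.
have h2 := norm_cone Fnorm p1 p2 q1 (l * q2) c0 d0.
have e1 : q1 * q2 * (l - 1) / D * p1 + (p1 * q2 - p2 * q1) / D * q1 = q1.
  by rewrite /D; field.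
have e2 : q1 * q2 * (l - 1) / D * p2 + (p1 * q2 - p2 * q1) / D * (l * q2) = q2.
  by rewrite /D; field.
have e3 : l * (p1 * q2 - p2 * q1) / D * p1 + (l - 1) * p1 * p2 / D * q1 = p1.
  by rewrite /D; field.
have e4 : l * (p1 * q2 - p2 * q1) / D * p2 + (l - 1) * p1 * p2 / D * (l * q2)
    = l * p2.
  by rewrite /D; field.
rewrite e1 e2 in h1; rewrite e3 e4 in h2.
have x0 : 0 < F (p1, p2).
  by apply: lt_le_trans (norm_ge_l Fnorm Fsym _ _); rewrite normr_gt0; lra.
have y0 : 0 < F (q1, l * q2).
  apply: lt_le_trans (norm_ge_r Fnorm Fsym _ _); rewrite normr_gt0 gt_eqF//.
  by rewrite mulr_gt0//; lra.
have k1 : (D - q1 * q2 * (l - 1)) * F (p1, p2)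
    <= (p1 * q2 - p2 * q1) * F (q1, l * q2).
  have h := le_trans le h1; rewrite -(ler_pM2l D0) in h.
  have e : D * (q1 * q2 * (l - 1) / D * F (p1, p2) +
      (p1 * q2 - p2 * q1) / D * F (q1, l * q2)) =
      q1 * q2 * (l - 1) * F (p1, p2) + (p1 * q2 - p2 * q1) * F (q1, l * q2).
    by field.
  by rewrite e in h; lra.
have k2 : (D - (l - 1) * p1 * p2) * F (q1, l * q2)
    <= l * (p1 * q2 - p2 * q1) * F (p1, p2).
  have h := le_trans le' h2; rewrite -(ler_pM2l D0) in h.
  have e : D * (l * (p1 * q2 - p2 * q1) / D * F (p1, p2) +
      (l - 1) * p1 * p2 / D * F (q1, l * q2)) =
      l * (p1 * q2 - p2 * q1) * F (p1, p2) + (l - 1) * p1 * p2 * F (q1, l * q2).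
    by field.
  by rewrite e in h; lra.
have A0 : 0 < D - q1 * q2 * (l - 1).
  have -> : D - q1 * q2 * (l - 1) = l * q2 * (p1 - q1) + q1 * (q2 - p2).
    by rewrite /D; ring.
  rewrite ltr_pwDl//; first by rewrite !mulr_gt0//; lra.
  by rewrite mulr_ge0//; lra.
have B0 : 0 < D - (l - 1) * p1 * p2.
  have -> : D - (l - 1) * p1 * p2 = l * p1 * (q2 - p2) + p2 * (p1 - q1).
    by rewrite /D; ring.
  rewrite ltr_pwDl//; first by rewrite !mulr_gt0//; lra.
  by rewrite mulr_ge0//; lra.
(* Multiplying [k1] by [k2] and cancelling the two positive norms leaves an inequality whose sides
   differ by (p1 - q1) (q2 - p2) (l - 1) D > 0 in the wrong direction. *)
have := ler_pM (ltW (mulr_gt0 A0 x0)) (ltW (mulr_gt0 B0 y0)) k1 k2.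
apply/negP; rewrite -ltNge.
have -> : (p1 * q2 - p2 * q1) * F (q1, l * q2) *
    (l * (p1 * q2 - p2 * q1) * F (p1, p2)) =
    l * (p1 * q2 - p2 * q1) ^+ 2 * (F (p1, p2) * F (q1, l * q2)) by ring.
have -> : (D - q1 * q2 * (l - 1)) * F (p1, p2) *
    ((D - (l - 1) * p1 * p2) * F (q1, l * q2)) =
    (D - q1 * q2 * (l - 1)) * (D - (l - 1) * p1 * p2) *
     (F (p1, p2) * F (q1, l * q2)) by ring.
rewrite ltr_pM2r ?mulr_gt0// -subr_gt0.
have -> : (D - q1 * q2 * (l - 1)) * (D - (l - 1) * p1 * p2) -
    l * (p1 * q2 - p2 * q1) ^+ 2 = (p1 - q1) * (q2 - p2) * (l - 1) * D.
  by rewrite /D; ring.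
by rewrite !mulr_gt0//; lra.
Qed.

Lemma norm_cross_le p1 p2 q1 q2 s t : 0 <= q1 -> q1 <= p1 -> 0 <= p2 ->
  p2 < q2 -> 0 < s -> s <= t ->
  F (p1, s * p2) <= F (q1, s * q2) -> F (p1, t * p2) <= F (q1, t * q2).
Proof.
move=> q10 qp1 p20 pq2 s0; rewrite le_eqVlt => /predU1P[<-//|st] le.
have t0 : 0 < t by apply: lt_trans st.
move: qp1; rewrite le_eqVlt => /predU1P[->|qp1].
  by rewrite (norm_le_r Fnorm Fsym) ?mulr_ge0 ?(ltW t0)// ler_pM2l// ltW.
have := @norm_cross p1 (s * p2) q1 (s * q2) (t / s) q10 qp1.
rewrite !mulrA divfK ?gt_eqF// => h; apply/ltW/h => //.
- by rewrite mulr_ge0// ltW.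
- by rewrite ltr_pM2l.
- by rewrite ltr_pdivlMr// mul1r.
Qed.

(** When q1 = p1, failure at t makes the norm equal to |p1| at height t q2 by [norm_flat_r], hence
    also at the lower height s q2, which leaves no room for strictness at s. *)
Lemma norm_cross_lt p1 p2 q1 q2 s t : 0 <= q1 -> q1 <= p1 -> 0 <= p2 ->
  p2 < q2 -> 0 < s -> s <= t ->
  F (p1, s * p2) < F (q1, s * q2) -> F (p1, t * p2) < F (q1, t * q2).
Proof.
move=> q10 qp1 p20 pq2 s0; rewrite le_eqVlt => /predU1P[<-//|st] lt.
have t0 : 0 < t by apply: lt_trans st.
move: qp1; rewrite le_eqVlt => /predU1P[qp1|qp1].
  subst q1; rewrite ltNge; apply/negP => le.
  have h : F (p1, t * q2) <= `|p1|.
    by apply: (norm_flat_r Fnorm Fsym _ _ le); rewrite ?mulr_ge0 ?ltr_pM2l// ltW.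
  move: lt; apply/negP; rewrite -leNgt.
  apply: le_trans (norm_ge_l Fnorm Fsym _ _); apply: le_trans h.
  have q20 : 0 < q2 by lra.
  by rewrite (norm_le_r Fnorm Fsym) ?mulr_ge0 ?(ltW s0) ?(ltW q20)// ler_pM2r// ltW.
have := @norm_cross p1 (s * p2) q1 (s * q2) (t / s) q10 qp1.
rewrite !mulrA divfK ?gt_eqF// => h; apply/h; last exact: ltW.
- by rewrite mulr_ge0// ltW.
- by rewrite ltr_pM2l.
- by rewrite ltr_pdivlMr// mul1r.
Qed.

(* The segment between the two points crosses the first axis, where the norm is
   the absolute value of the abscissa. *)
Lemma norm_add_lt x y x' y' m : 0 < y -> y' < 0 -> `|x| < `|x'| ->
  F (x, y) <= m -> F (x', y') <= m -> F (x + x', y + y') < 2 * m.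
Proof.
move=> y0 y'0 xx' le le'.
have x'm : `|x'| <= m by apply: le_trans (norm_ge_l Fnorm Fsym _ _) le'.
have [yy'|yy'] := leP (- y') y.
  have k0 : 0 < - y' / y by rewrite divr_gt0// oppr_gt0.
  have k1 : - y' / y <= 1 by rewrite ler_pdivrMr// mul1r.
  set k := - y' / y in k0 k1.
  have k1' : 0 <= 1 - k by lra.
  have := @norm_cone F Fnorm 1 (1 - k) (x' + k * x) 0 x y ler01 k1'.
  have -> : 1 * (x' + k * x) + (1 - k) * x = x + x' by ring.
  have -> : 1 * 0 + (1 - k) * y = y + y' by rewrite /k; field; rewrite gt_eqF.
  rewrite (norm_x0 Fnorm Fsym) => h.
  have : `|x' + k * x| <= `|x'| + k * `|x|.
    by rewrite (le_trans (ler_normD _ _))// normrM (gtr0_norm k0).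
  nra.
have k0 : 0 < y / - y' by rewrite divr_gt0// oppr_gt0.
have k1 : y / - y' < 1 by rewrite ltr_pdivrMr ?oppr_gt0// mul1r.
set k := y / - y' in k0 k1.
have k1' : 0 <= 1 - k by lra.
have := @norm_cone F Fnorm 1 (1 - k) (x + k * x') 0 x' y' ler01 k1'.
have -> : 1 * (x + k * x') + (1 - k) * x' = x + x' by ring.
have -> : 1 * 0 + (1 - k) * y' = y + y' by rewrite /k; field; rewrite lt_eqF.
rewrite (norm_x0 Fnorm Fsym) => h.
have : `|x + k * x'| <= `|x| + k * `|x'|.
  by rewrite (le_trans (ler_normD _ _))// normrM (gtr0_norm k0).
nra.
Qed.

Lemma norm_comp_continuous (T : topologicalType) (f g : T -> R) :
  continuous f -> continuous g -> continuous (fun z => F (f z, g z)).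
Proof.
move=> cf cg z; apply: (@continuous_comp _ _ _ (fun z => (f z, g z)) F);
  last exact: norm_continuous.
exact: (cvg_pair (cf z) (cg z)).
Qed.

End Crossing.
End SymmetricNorm.

(** * The singularization area *)

Section Area.
Context {R : realType}.
Implicit Types (F : R * R -> R) (u v t : R).

(** At a zero of f - g the two functions agree, and the covering hypothesis makes their value
    nonnegative. This finds one scaling at which two comparisons hold at once. *)
Lemma both_ge0_IVT (f g : R -> R) (a b : R) : a <= b ->
  continuous f -> continuous g -> 0 <= f a -> 0 <= g b ->
  (forall c, a <= c -> 0 <= f c \/ 0 <= g c) ->
  exists c, [/\ a <= c, 0 <= f c & 0 <= g c].
Proof.
move=> ab cf cg fa gb fg.
have [ga|ga] := leP 0 (g a); first by exists a.
have [fb|fb] := leP 0 (f b); first by exists b.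
have cfg : continuous (fun c => f c - g c).
  by move=> x; apply: cvgB; [exact: cf|exact: cg].
have [|c] := @IVT _ _ a b 0 ab (continuous_subspaceT cfg).
  by rewrite ge_min le_max; apply/andP; split; apply/orP; [right|left]; lra.
rewrite in_itv/= => /andP[ac cb] /eqP; rewrite subr_eq0 => /eqP fgc.
by exists c; split => //; case: (fg c ac) => //; rewrite fgc.
Qed.

(* With u = u_n and v = v_n, the vectors (v, t), (1, t u) and (1 + v, t (1 - u))
   are, up to signs and a common rescaling, those of the convergents n - 1, n and
   n + 1 when b_(n+1) = 1; the condition says that for no scaling is the middle
   one strictly shorter than both its neighbours. *)
Definition shadowed F : set (R * R) := [set z | forall t, 0 < t ->
  F (z.2, t) <= F (1, t * z.1) \/ F (1 + z.2, t * (1 - z.1)) <= F (1, t * z.1)].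

Definition shadow_area F : set (R * R) :=
  [set z | [/\ 2^-1 < z.1 < 1, 0 <= z.2 <= 1 & shadowed F z]].

Section Geometry.
Context (F : R * R -> R) (Fnorm : is_norm F) (Fsym : strongly_symmetric F).

(** By crossing, the comparison with the left neighbour passes to all smaller scalings and that with
    the right neighbour to all larger ones. *)
Lemma shadowed_of_ex u v t : 2^-1 < u < 1 -> 0 <= v <= 1 -> 0 < t ->
  F (v, t) <= F (1, t * u) -> F (1 + v, t * (1 - u)) <= F (1, t * u) ->
  shadowed F (u, v).
Proof.
move=> /andP[u2 u1] /andP[v0 v1] t0 left_le right_le s s0 /=.
have [st|ts] := leP s t.
  left; rewrite leNgt; apply/negP => lt; move: left_le; apply/negP.
  rewrite -ltNge.
  have := @norm_cross_lt _ F Fnorm Fsym 1 u v 1 s t v0 v1 _ u1 s0 st.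
  by rewrite !mulr1; apply => //; lra.
right; apply: (@norm_cross_le _ F Fnorm Fsym (1 + v) (1 - u) 1 u t s) => //; lra.
Qed.

Lemma shadowed_ex u v : 2^-1 < u < 1 -> 0 <= v <= 1 -> shadowed F (u, v) ->
  v < 1 /\ exists t, [/\ 0 < t, F (v, t) <= F (1, t * u) &
    F (1 + v, t * (1 - u)) <= F (1, t * u)].
Proof.
move=> /andP[u2 u1] /andP[v0 v1] sh.
have v_lt1 : v < 1.
  rewrite lt_neqAle v1 andbT; apply/eqP => v1'; subst v.
  have d0 : 0 < 1 + u by lra.
  (* For v = 1, any t with t u < 1 < t refutes both alternatives. *)
  pose t := 2 / (1 + u).
  have t1 : 1 < t by rewrite /t ltr_pdivlMr//; lra.
  have tu1 : t * u < 1 by rewrite /t mulrAC ltr_pdivrMr//; lra.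
  have tu0 : 0 < t * u by rewrite mulr_gt0//; lra.
  have [|/= le|/= le] := sh t; first by lra.
    have := norm_flat_r Fnorm Fsym (ltW tu0) (lt_trans tu1 t1) le.
    rewrite normr1 => h; have := norm_ge_r Fnorm Fsym 1 t.
    rewrite gtr0_norm; lra.
  have := norm_ge_l Fnorm Fsym (1 + 1) (t * (1 - u)).
  have := norm_le_sum Fnorm Fsym 1 (t * u).
  rewrite normr1 (gtr0_norm tu0) gtr0_norm; lra.
split => //.
(* The left comparison holds at 1 - v because F(v, 1 - v) <= 1, and the right one at b because b (2
   u - 1) >= 1 + v. *)
pose b := (1 - v) + (1 + v) / (2 * u - 1).
have d0 : 0 < 2 * u - 1 by lra.
have q0 : 0 <= (1 + v) / (2 * u - 1) by rewrite divr_ge0//; lra.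
have [||||||c [ac fc gc]] := @both_ge0_IVT (fun t => F (1, t * u) - F (v, t))
    (fun t => F (1, t * u) - F (1 + v, t * (1 - u))) (1 - v) b.
- by rewrite /b; lra.
- move=> t; apply: cvgB; apply: norm_comp_continuous => // s;
    first [exact: cvg_cst|exact: cvg_id|
           by apply: cvgM; [exact: cvg_id|exact: cvg_cst]].
- move=> t; apply: cvgB; apply: norm_comp_continuous => // s;
    first [exact: cvg_cst|exact: cvg_id|
           by apply: cvgM; [exact: cvg_id|exact: cvg_cst]].
- have := norm_le_sum Fnorm Fsym v (1 - v).
  have := norm_ge_l Fnorm Fsym 1 ((1 - v) * u).
  by rewrite normr1 !ger0_norm; lra.
- have b0 : 0 < b by rewrite /b; lra.
  have := norm_le_sum Fnorm Fsym (1 + v) (b * (1 - u)).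
  have := norm_ge_r Fnorm Fsym 1 (b * u).
  rewrite !ger0_norm ?mulr_ge0//; try lra.
  have : 1 + v <= b * (2 * u - 1) by rewrite /b mulrDl divfK ?gt_eqF//; nra.
  nra.
- by move=> c ac; have [|/= ?|/= ?] := sh c; [lra|left; lra|right; lra].
by exists c; split; lra.
Qed.

(** The second point is the image of (u, v) under the natural extension, since floor(1/u) = 1. Up to
    signs and a common rescaling, the convergents n - 1 to n + 2 give (v, t), (1, t u), (1 + v, t (1
    - u)) and (2 + v, t (2 u - 1)). *)
Lemma shadowed_not_consecutive u v : 2^-1 < u < 1 -> 0 <= v <= 1 ->
  2^-1 < u^-1 - 1 -> shadowed F (u, v) ->
  ~ shadowed F (u^-1 - 1, (v + 1)^-1).
Proof.
move=> /andP[u2 u1] /andP[v0 v1] u'2 sh sh'.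
have u0 : 0 < u by lra.
have un0 : u != 0 by rewrite gt_eqF.
have v10 : 0 < 1 + v by lra.
have vn0 : 1 + v != 0 by rewrite gt_eqF.
have d0 : 0 < 2 * u - 1 by lra.
(* The second shadow condition, written in the coordinates of the first: its vectors are multiplied
   by 1 + v and its scaling is t u / (1 + v). *)
have shf t : 0 < t -> F (1, t * u) <= F (1 + v, t * (1 - u)) \/
    F (2 + v, t * (2 * u - 1)) <= F (1 + v, t * (1 - u)).
  move=> t0; have t'0 : 0 < t * u / (1 + v) by rewrite divr_gt0// mulr_gt0.
  have v10' := ltW v10.
  have := sh' _ t'0 => /=; rewrite addrC.
  have eF : F (1, t * u / (1 + v) * (u^-1 - 1)) =
      (1 + v)^-1 * F (1 + v, t * (1 - u)).
    rewrite -(norm_pscale Fnorm) ?invr_ge0// mulVf//; congr (F (_, _)); field.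
    by rewrite vn0.
  rewrite eF.
  have -> : F ((1 + v)^-1, t * u / (1 + v)) = (1 + v)^-1 * F (1, t * u).
    by rewrite -(norm_pscale Fnorm) ?invr_ge0// mulr1; congr (F (_, _)); field.
  have -> : F (1 + (1 + v)^-1, t * u / (1 + v) * (1 - (u^-1 - 1))) =
      (1 + v)^-1 * F (2 + v, t * (2 * u - 1)).
    rewrite -(norm_pscale Fnorm) ?invr_ge0//; congr (F (_, _)); field => //.
    by rewrite vn0.
  by rewrite !ler_pM2l ?invr_gt0.
(* The strict triangle inequality is applied below with ordinate - v < 0. For v = 0 the scaling 2
   refutes both alternatives of [shf] directly. *)
have [v00|vn] := eqVneq v 0.
  subst v; have [//| |] := shf 2.
    rewrite addr0 => le; have := norm_flat_r Fnorm Fsym _ _ le.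
    have := norm_ge_r Fnorm Fsym 1 (2 * u).
    rewrite normr1 ger0_norm; last lra.
    move=> h1 h2; suff : 2 * u <= 1 by lra.
    by apply: le_trans h1 (h2 _ _); lra.
  rewrite !addr0.
  have := norm_ge_l Fnorm Fsym 2 (2 * (2 * u - 1)).
  have := norm_le_sum Fnorm Fsym 1 (2 * (1 - u)).
  by rewrite normr1 !ger0_norm; lra.
have {}v0 : 0 < v by rewrite lt_neqAle eq_sym vn.
(* The outer vectors have equal length somewhere in [2, b]: F(v, 2) <= 2 + v, while b is chosen so
   that 2 + v + b (2 u - 1) = b. *)
pose b := (2 + v) / (2 * (1 - u)).
have c0 : 0 < 2 * (1 - u) by lra.
have b2 : 2 <= b by rewrite /b ler_pdivlMr//; lra.
have cf : continuous (fun t => F (v, t) - F (2 + v, t * (2 * u - 1))).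
  move=> t; apply: cvgB; apply: norm_comp_continuous => // s;
    first [exact: cvg_cst|exact: cvg_id|
           by apply: cvgM; [exact: cvg_id|exact: cvg_cst]].
have [|t] := @IVT _ _ 2 b 0 b2 (continuous_subspaceT cf).
  rewrite ge_min le_max; apply/andP; split; apply/orP; [left|right].
    have := norm_le_sum Fnorm Fsym v 2.
    have := norm_ge_l Fnorm Fsym (2 + v) (2 * (2 * u - 1)).
    by rewrite !ger0_norm /=; [|lra..] => ? ?; rewrite subr_le0; lra.
  have := norm_ge_r Fnorm Fsym v b.
  have := norm_le_sum Fnorm Fsym (2 + v) (b * (2 * u - 1)).
  have e : b * (2 * (1 - u)) = 2 + v by rewrite /b divfK ?gt_eqF.
  have ? : 0 <= b * (2 * u - 1) by rewrite mulr_ge0//; lra.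
  by rewrite !ger0_norm /=; [|lra..] => ? ?; rewrite subr_ge0; lra.
rewrite in_itv /= => /andP[t2 _] /eqP; rewrite subr_eq0 => /eqP eqm.
set m := F (v, t) in eqm.
have t0 : 0 < t by lra.
(* Up to signs, twice each inner vector is the sum or the difference of the outer ones, both of
   length m. *)
have em : F (1, t * u) < m.
  have := @norm_add_lt _ _ (is_norm_swap Fnorm) (strongly_symmetric_swap Fsym)
    (t * (2 * u - 1)) (2 + v) t (- v) m.
  rewrite /swap_norm /= norm_Nl// -eqm.
  have -> : 2 + v - v = 2 * 1 by ring.
  have -> : t * (2 * u - 1) + t = 2 * (t * u) by ring.
  rewrite norm_pscale// ltr_pM2l//; apply => //; try lra.
  rewrite !gtr0_norm// ?mulr_gt0//; nra.
have fm : F (1 + v, t * (1 - u)) < m.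
  have := @norm_add_lt _ _ Fnorm Fsym (- v) t (- (2 + v)) (- (t * (2 * u - 1))) m.
  have -> : - v + - (2 + v) = 2 * - (1 + v) by ring.
  have -> : t + - (t * (2 * u - 1)) = 2 * (t * (1 - u)) by ring.
  rewrite norm_pscale// ltr_pM2l// !norm_Nl// norm_Nr// -eqm; apply => //.
    by rewrite oppr_lt0 mulr_gt0.
  by rewrite !normrN !gtr0_norm//; lra.
(* At this larger scaling the third vector is still shorter than m, the norm being 1-Lipschitz in
   each coordinate. So [shf] at s and [sh] at t give opposite comparisons of the inner vectors,
   against crossing. *)
pose s := t + (m - F (1 + v, t * (1 - u))).
have s0 : 0 < s by rewrite /s; lra.
have ts : t < s by rewrite /s; lra.
have fs : F (1 + v, s * (1 - u)) < F (2 + v, s * (2 * u - 1)).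
  apply: (@lt_le_trans _ _ m); last first.
    rewrite eqm (norm_le_r Fnorm Fsym)//; first by rewrite mulr_ge0//; lra.
    by rewrite ler_pM2r// ltW.
  have := norm_dist Fnorm Fsym (1 + v) (s * (1 - u)) (1 + v) (t * (1 - u)).
  rewrite subrr normr0 add0r -mulrBl ler_norml => /andP[_].
  rewrite ger0_norm; last by rewrite mulr_ge0//; lra.
  have : (s - t) * (1 - u) < s - t by nra.
  have -> : s - t = m - F (1 + v, t * (1 - u)) by rewrite /s; ring.
  by lra.
have le_s : F (1, s * u) <= F (1 + v, s * (1 - u)).
  by case: (shf s s0) => //; rewrite leNgt fs.
have le_t : F (1 + v, t * (1 - u)) <= F (1, t * u).
  by case: (sh t t0) => //=; rewrite -/m leNgt em.
suff : F (1 + v, s * (1 - u)) < F (1, s * u) by rewrite ltNge le_s.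
have := @norm_cross _ F Fnorm Fsym (1 + v) (t * (1 - u)) 1 (t * u) (s / t).
rewrite !mulrA divfK ?gt_eqF//; apply => //; try lra.
- by rewrite mulr_ge0//; lra.
- by rewrite ltr_pM2l//; lra.
- by rewrite ltr_pdivlMr// mul1r.
Qed.

End Geometry.
End Area.

(** * Measurability and null sets in the plane *)

Section PlaneMeasure.
Context {R : realType}.
Implicit Types (A : set (R * R)).

(** Measurability refers to the product sigma-algebra; an open set is the countable union of the
    squares with rational centre and radius that it contains. *)
Lemma open_prod_measurable A : open A ->
  measurable (A : set (measurableTypeR R * measurableTypeR R)%type).
Proof.
move=> oA.
pose B (q : rat * rat * rat) : set (R * R) :=
  ball (ratr q.1.1 : R) (ratr q.2) `*` ball (ratr q.1.2 : R) (ratr q.2).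
pose B' q := if `[< B q `<=` A >] then B q else set0.
have -> : A = \bigcup_q B' q.
  apply/seteqP; split => [[x y] Axy|z [q _]]; last first.
    by rewrite /B'; case: asboolP => // BA /BA.
  have [e /= e0 eA] : nbhs_ball (x, y) A.
    by apply/nbhs_ballP; move: (oA); rewrite openE => /(_ _ Axy).
  have e20 : e / 2 > 0 by rewrite divr_gt0.
  have [r] : exists r : rat, 0 < (ratr r : R) < e / 2.
    by have [r] := rat_in_itvoo e20; rewrite in_itv /=; exists r.
  move=> /andP[r0 re].
  have hr (c : R) : exists q : rat, ball (ratr q : R) (ratr r) c.
    have [q] : exists q : rat, ratr q \in `]c - ratr r, c + ratr r[.
      by apply: rat_in_itvoo; lra.
    rewrite in_itv /= => /andP[q1 q2]; exists q.
    by rewrite /ball /= ltr_norml; lra.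
  have [qx hx] := hr x; have [qy hy] := hr y.
  exists ((qx, qy), r) => //; rewrite /B'; case: asboolP => // nBA.
  exfalso; apply: nBA => -[x' y'] [/= hx' hy']; apply: eA; split => /=.
    rewrite /ball /= in hx hx' *; have := ler_distD (ratr qx : R) x x'.
    by rewrite (distrC x (ratr qx)); lra.
  rewrite /ball /= in hy hy' *; have := ler_distD (ratr qy : R) y y'.
  by rewrite (distrC y (ratr qy)); lra.
apply: countable_bigcupT_measurable => [|q]; first exact: countableP.
rewrite /B'; case: asboolP => // _.
by apply: measurableX; apply: open_measurable; exact: ball_open.
Qed.

Lemma closed_prod_measurable A : closed A ->
  measurable (A : set (measurableTypeR R * measurableTypeR R)%type).
Proof.
by move=> /closed_openC/open_prod_measurable/measurableC; rewrite setCK.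
Qed.

(** The product measure integrates the measures of the vertical sections, which are countable off
    the line x = a; that line is itself null. *)
Lemma null_vertical_sections A (a : R) :
  measurable (A : set (measurableTypeR R * measurableTypeR R)%type) ->
  (forall x, x != a -> countable (xsection A x)) ->
  ((@lebesgue_measure R \x @lebesgue_measure R) A = 0)%E.
Proof.
move=> mA cA; pose L : set (R * R) := [set a] `*` setT.
have mL : measurable (L : set (measurableTypeR R * measurableTypeR R)%type).
  by apply: measurableX => //; exact: measurable_set1.
have L0 : ((@lebesgue_measure R \x @lebesgue_measure R) L = 0)%E.
  transitivity (@lebesgue_measure R [set a] * @lebesgue_measure R setT)%E.
    by apply: product_measure1E => //; exact: measurable_set1.
  by rewrite lebesgue_measure_set1 mul0e.
have AL0 : ((@lebesgue_measure R \x @lebesgue_measure R) (A `\` L) = 0)%E.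
  rewrite /product_measure1; apply: integral0_eq => x _ /=.
  have [->|xa] := eqVneq x a.
    have -> : xsection (A `\` L) a = set0; last by rewrite measure0.
    by rewrite -subset0 => y; rewrite /xsection /= inE /= => -[_]; apply.
  apply: countable_lebesgue_measure0; apply: sub_countable (cA _ xa).
  by apply: subset_card_le => y; rewrite /xsection /= !inE => -[].
apply/eqP; rewrite eq_le measure_ge0 andbT.
have mAL := measurableD mA mL.
rewrite -[leRHS]AL0 -(measureU0 mAL mL L0) le_measure// ?inE//.
  exact: measurableU.
by move=> z Az; have [Lz|nLz] := pselect (L z); [right|left].
Qed.

End PlaneMeasure.

Section NullDensity.
Context {R : realType}.
Implicit Types (A : set (R * R)).

Lemma Omega0_measurable :
  measurable (@Omega0 R : set (measurableTypeR R * measurableTypeR R)%type).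
Proof. by apply: measurableX; exact: measurable_itv. Qed.

Lemma omega_null A (a : R) :
  measurable (A : set (measurableTypeR R * measurableTypeR R)%type) ->
  (forall x, x != a -> countable (xsection (A `&` Omega0) x)) -> omega A = 0%E.
Proof.
move=> mA cA; have mN := measurableI _ _ mA Omega0_measurable.
apply: null_set_integral => //; last exact: null_vertical_sections cA.
apply/measurable_EFinP; apply: measurable_funM; first exact: measurable_cst.
(* Inversion is continuous only away from 0, so the composition goes through the open half-line,
   which contains (1 + u v)^2 on [Omega0]. *)
apply: (@measurable_comp _ _ _ _ (measurableTypeR R) (measurableTypeR R)
  `]0, +oo[%classic (@GRing.inv R) _ (fun z : R * R => (1 + z.1 * z.2) ^+ 2)).
- exact: measurable_itv.
- move=> _ [z [_ [z1 z2]] <-] /=; move: z1 z2 => /=; rewrite !in_itv /= andbT.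
  by move=> /andP[? _] /andP[? _]; rewrite exprn_gt0// ltr_pwDl// mulr_ge0.
- apply: open_continuous_measurable_fun; first exact: interval_open.
  move=> x; rewrite inE /= in_itv /= andbT => x0.
  by apply: inv_continuous; rewrite gt_eqF.
- apply: measurable_funX; apply: measurable_funD; first exact: measurable_cst.
  by apply: measurable_funM; apply: measurable_funTS;
    [exact: measurable_fst|exact: measurable_snd].
Qed.

End NullDensity.

(** * The shadow area is a singularization area *)

Section SingularizationArea.
Context {R : realType}.
Context (F : R * R -> R) (Fnorm : is_norm F) (Fsym : strongly_symmetric F).

Lemma continuous_lt_open (T : topologicalType) (f g : T -> R) :
  continuous f -> continuous g -> open [set z | f z < g z].
Proof.
move=> cf cg.
have -> : [set z | f z < g z] = (fun z => g z - f z) @^-1` [set x | 0 < x].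
  by apply/seteqP; split => z /=; rewrite subr_gt0.
apply: open_comp; last exact: open_gt.
by move=> z _; apply: cvgB; [exact: cg|exact: cf].
Qed.

Lemma fst_continuous : continuous (fst : R * R -> R).
Proof. by move=> z; exact: cvg_fst. Qed.

Lemma snd_continuous : continuous (snd : R * R -> R).
Proof. by move=> z; exact: cvg_snd. Qed.

Lemma middle_continuous (t : R) : continuous (fun z : R * R => F (1, t * z.1)).
Proof.
apply: norm_comp_continuous => // z; first exact: cvg_cst.
by apply: cvgM; [exact: cvg_cst|exact: fst_continuous].
Qed.

Lemma left_continuous (t : R) : continuous (fun z : R * R => F (z.2, t)).
Proof.
by apply: norm_comp_continuous => // z; [exact: snd_continuous|exact: cvg_cst].
Qed.

Lemma right_continuous (t : R) :
  continuous (fun z : R * R => F (1 + z.2, t * (1 - z.1))).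
Proof.
apply: norm_comp_continuous => // z.
  by apply: cvgD; [exact: cvg_cst|exact: snd_continuous].
apply: cvgM; first exact: cvg_cst.
by apply: cvgB; [exact: cvg_cst|exact: fst_continuous].
Qed.

Lemma shadowed_closed : closed (shadowed F).
Proof.
have -> : shadowed F = ~` \bigcup_(t in [set t : R | 0 < t])
    ([set z | F (1, t * z.1) < F (z.2, t)] `&`
     [set z | F (1, t * z.1) < F (1 + z.2, t * (1 - z.1))]).
  apply/seteqP; split => z.
    move=> sh [t /= t0 [+ +]]; rewrite !ltNge.
    by case: (sh t t0) => ->.
  move=> nz t t0; have [?|lt1] := leP (F (z.2, t)) (F (1, t * z.1)); first by left.
  right; rewrite leNgt; apply/negP => lt2; apply: nz; by exists t.
apply: open_closedC; apply: bigcup_open => t _; apply: openI;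
  apply: continuous_lt_open.
- exact: middle_continuous.
- exact: left_continuous.
- exact: middle_continuous.
- exact: right_continuous.
Qed.

Lemma shadow_area_borel : <<s @open (R * R)%type >> (shadow_area F).
Proof.
pose B := <<s @open (R * R)%type >>.
have [B0 BC BU] : sigma_algebra setT B by exact: smallest_sigma_algebra.
have Bo A : open A -> B A by move=> oA; exact: sub_sigma_algebra.
have Bc A : closed A -> B A.
  move=> cA; have := BC _ (Bo _ (closed_openC cA)).
  by rewrite setTD setCK.
have BI A A' : B A -> B A' -> B (A `&` A').
  have {}BC X : B X -> B (~` X) by rewrite -setTD; exact: BC.
  move=> BA BA'; rewrite -(setCK (A `&` A')) setCI -bigcup2E.
  by refine (BC _ (BU _ _)) => -[|[|i]] /=; [exact: (BC _ BA)|exact: (BC _ BA')|].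
have -> : shadow_area F = ([set z | 2^-1 < z.1] `&` [set z | z.1 < 1]) `&`
    ((~` [set z | z.2 < 0] `&` ~` [set z | 1 < z.2]) `&` shadowed F).
  apply/seteqP; split => z.
    move=> [/andP[? ?] /andP[? ?] ?]; do 3?split => //=.
      by apply/negP; rewrite -leNgt.
    by apply/negP; rewrite -leNgt.
  move=> [[? ?] [[/= /negP + /negP]]]; rewrite -!leNgt => ? ? ?.
  by split => //; apply/andP.
have op (f g : R * R -> R) :
    continuous f -> continuous g -> open [set z | f z < g z].
  exact: continuous_lt_open.
have cc (x : R) : continuous (fun _ : R * R => x) by move=> z; exact: cvg_cst.
apply: BI; first by apply: Bo; apply: openI; apply: op => //; exact: fst_continuous.
apply: Bc; apply: closedI; last exact: shadowed_closed.
by apply: closedI; apply: open_closedC; apply: op => //; exact: snd_continuous.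
Qed.

(** Lowering v0 to v makes the right comparison strict, and then slightly lowering the scaling makes
    the left one strict by crossing. Strict comparisons persist nearby, where [shadowed_of_ex]
    applies. *)
Lemma shadow_area_interior (u v0 v : R) : 2^-1 < u < 1 -> 0 < v -> v < v0 ->
  v0 <= 1 -> shadowed F (u, v0) -> interior (shadow_area F) (u, v).
Proof.
move=> u12 v_gt0 vv0 v01 sh.
have v00 : 0 <= v0 <= 1 by rewrite v01 andbT; lra.
have [v0_lt1 [t [t0 le_l le_r]]] := shadowed_ex Fnorm Fsym u12 v00 sh.
move: (u12) => /andP[u2 u1].
have lt_r : F (1 + v, t * (1 - u)) < F (1, t * u).
  rewrite ltNge; apply/negP => ge.
  have := norm_flat_l (x := 1 + v) (x' := 1 + v0) (y := t * (1 - u)) Fnorm Fsym.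
  have := norm_ge_r Fnorm Fsym 1 (t * u).
  have tu : 0 < t * u by rewrite mulr_gt0//; lra.
  have tu' : t * (1 - u) < t * u by rewrite ltr_pM2l//; lra.
  have tu'' : 0 < t * (1 - u) by rewrite mulr_gt0//; lra.
  rewrite (gtr0_norm tu) (gtr0_norm tu'') => h1 h2.
  have ? : F (1 + v0, t * (1 - u)) <= t * (1 - u).
    by apply: h2; [lra|lra|exact: le_trans ge].
  have ? : F (1 + v, t * (1 - u)) <= F (1 + v0, t * (1 - u)).
    by apply: norm_le_l => //; lra.
  lra.
(* Half the gap outweighs the loss in F(1, t u), by the Lipschitz bound; t / 2 keeps s positive. *)
pose d := Num.min ((F (1, t * u) - F (1 + v, t * (1 - u))) / 2) (t / 2).
have d0 : 0 < d by rewrite lt_min !divr_gt0// subr_gt0.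
have dt : d <= t / 2 by rewrite ge_min lexx orbT.
have dG : d <= (F (1, t * u) - F (1 + v, t * (1 - u))) / 2 by rewrite ge_min lexx.
pose s := t - d.
have s0 : 0 < s by rewrite /s; lra.
have st : s < t by rewrite /s; lra.
have slt_r : F (1 + v, s * (1 - u)) < F (1, s * u).
  have h1 : F (1 + v, s * (1 - u)) <= F (1 + v, t * (1 - u)).
    by apply: norm_le_r => //; [rewrite mulr_ge0//; lra|rewrite ler_pM2r//; lra].
  have := norm_dist Fnorm Fsym 1 (t * u) 1 (s * u).
  rewrite subrr normr0 add0r -mulrBl ler_norml => /andP[_].
  rewrite ger0_norm; last by rewrite mulr_ge0//; lra.
  have : (t - s) * u < t - s by nra.
  have -> : t - s = d by rewrite /s; ring.
  lra.
have slt_l : F (v, s) < F (1, s * u).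
  apply: (@le_lt_trans _ _ (F (v0, s))); first by apply: norm_le_l => //; lra.
  rewrite ltNge; apply/negP => ge; move: le_l; apply/negP; rewrite -ltNge.
  have := @norm_cross _ F Fnorm Fsym 1 (s * u) v0 s (t / s).
  rewrite !mulrA divfK ?gt_eqF//; apply => //; try lra.
  - by rewrite mulr_ge0//; lra.
  - by rewrite -[ltRHS]mulr1 ltr_pM2l.
  - by rewrite ltr_pdivlMr// mul1r.
have cc (x : R) : continuous (fun _ : R * R => x) by move=> z; exact: cvg_cst.
pose W : set (R * R) :=
  ([set z | F (z.2, s) < F (1, s * z.1)] `&`
   [set z | F (1 + z.2, s * (1 - z.1)) < F (1, s * z.1)]) `&`
  (([set z | 2^-1 < z.1] `&` [set z | z.1 < 1]) `&`
   ([set z | 0 < z.2] `&` [set z | z.2 < 1])).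
have oW : open W.
  do ?apply: openI; apply: continuous_lt_open => //;
  by [exact: middle_continuous|exact: left_continuous|exact: right_continuous|
      exact: fst_continuous|exact: snd_continuous].
have WS : W `<=` shadow_area F.
  move=> [x y] [[/= w1 w2] [[/= w3 w4] [/= w5 w6]]].
  have x12 : 2^-1 < x < 1 by rewrite w3.
  have y01 : 0 <= y <= 1 by rewrite !ltW.
  by split => //=; apply: (shadowed_of_ex Fnorm Fsym x12 y01 s0); exact: ltW.
apply: filterS WS _; apply: open_nbhs_nbhs; split => //.
by split; split => //=; split => //=; lra.
Qed.

Lemma shadow_area_singularization : singularization_area (shadow_area F).
Proof.
split.
- exact: shadow_area_borel.
- move=> z [/andP[z2 z1] z01 _]; split; rewrite /= in_itv //=.
  by rewrite z1 andbT; lra.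
- apply: (@omega_null _ _ 2^-1).
    apply: measurableD; first by apply: closed_prod_measurable; exact: closed_closure.
    by apply: open_prod_measurable; exact: open_interior.
  (* Off the line u = 1/2, where the area may accumulate without meeting it, each section of the
     boundary has at most one point with v > 0: of two, the upper is shadowed by closedness, so the
     lower is interior. *)
  move=> x x2; pose C := [set v : R | 0 < v /\
    xsection (boundary (shadow_area F) `&` Omega0) x v].
  have C1 v w : C v -> C w -> ~ v < w.
    move=> [v0]; rewrite /xsection /= !inE => -[[_ nint] _].
    move=> [w0]; rewrite /xsection /= !inE => -[[cl _] [/= xO wO]] vw.
    have cle (f : R * R -> R) (c : R) : continuous f ->
        shadow_area F `<=` [set z | c <= f z] -> c <= f (x, w).
      move=> cf sub; have : closed [set z | c <= f z].
        have -> : [set z | c <= f z] = ~` [set z | f z < c].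
          by apply/seteqP; split => z /=; rewrite leNgt => /negP.
        by apply/open_closedC/continuous_lt_open => // z; exact: cvg_cst.
      by move=> /closure_id clE; have := closure_subset sub cl; rewrite -clE.
    have x12 : 2^-1 < x < 1.
      move: xO; rewrite in_itv /= => /andP[_ ->]; rewrite andbT lt_neqAle eq_sym x2.
      by apply: (cle fst); [exact: fst_continuous|move=> z [/andP[/ltW]]].
    apply: nint; apply: (@shadow_area_interior x w v) => //.
      by move: wO; rewrite in_itv /= => /andP[].
    have sub : shadow_area F `<=` shadowed F by move=> z [].
    have := closure_subset sub cl.
    by rewrite -((closure_id _).1 shadowed_closed).
  apply: (@sub_countable _ _ _ ([set 0] `|` C)).
    apply: subset_card_le => v xv; have [v0|v0] := ltP 0 v; first by right.
    left; move: xv; rewrite /xsection /= inE => -[_ [_ /=]].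
    by rewrite in_itv /= => /andP[v0' _]; apply/eqP; rewrite eq_le v0 v0'.
  apply/finite_set_countable; rewrite finite_setU; split; first exact: finite_set1.
  have [[w Cw]|nC] := pselect (exists w, C w).
    apply: (sub_finite_set _ (finite_set1 w)) => v Cv /=.
    by case: (ltgtP v w) => // lt; [case: (C1 _ _ Cv Cw)|case: (C1 _ _ Cw Cv)].
  suff -> : C = set0 by exact: finite_set0.
  by rewrite -subset0 => v Cv; apply: nC; exists v.
- move=> z [/andP[z2 z1] z01 _]; split; rewrite /= in_itv //=.
  by rewrite z1 ltW.
- move=> _ [[[u v] [/= u12 v01 sh]] <-] [/= u'12 _ sh'].
  exfalso; move: u'12 sh'; rewrite /natural_extension /=.
  move: (u12) => /andP[u2 u1].
  have u0 : 0 < u by lra.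
  rewrite gt_eqF//=.
  have -> : Num.floor u^-1 = 1.
    apply: floor_def; rewrite ltW ?invf_gt1//=.
    by rewrite -[ltRHS]invrK ltf_pV2// posrE invr_gt0.
  move=> /andP[u'2 _].
  exact: (shadowed_not_consecutive Fnorm Fsym u12 v01 u'2 sh).
Qed.

End SingularizationArea.

(** * Semi-regular continued fractions *)

Section Continuants.
Implicit Types (a eps : nat -> int).

(* The recurrence of numerators and denominators; the index is shifted by one,
   so that cf_num m.+1 / cf_den m.+1 is the convergent of index m and index 0
   stands for the formal convergent 1 / 0. *)
Fixpoint cf_rec a eps (x0 x1 : int) (m : nat) : int :=
  match m with
  | 0 => x0
  | m'.+1 => match m' with
             | 0 => x1
             | m''.+1 => a m' * cf_rec a eps x0 x1 m' +
                         eps m' * cf_rec a eps x0 x1 m''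
             end
  end.

Definition cf_num a eps := cf_rec a eps 1 (a 0%N).
Definition cf_den a eps := cf_rec a eps 0 1.

Lemma cf_numSS a eps m : cf_num a eps m.+2 =
  a m.+1 * cf_num a eps m.+1 + eps m.+1 * cf_num a eps m.
Proof. by []. Qed.

Lemma cf_denSS a eps m : cf_den a eps m.+2 =
  a m.+1 * cf_den a eps m.+1 + eps m.+1 * cf_den a eps m.
Proof. by []. Qed.

Definition cf_admissible a eps :=
  [/\ forall m, (0 < m)%N -> 0 < a m,
      forall m, (0 < m)%N -> eps m = 1 \/ eps m = -1
    & forall m, (0 < m)%N -> 1 <= a m + eps m.+1].

Section Admissible.
Context (a eps : nat -> int) (adm : cf_admissible a eps).
Local Notation P := (cf_num a eps).
Local Notation Q := (cf_den a eps).

(** The determinant is a sign depending on the [eps]; squaring avoids tracking it. *)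
Lemma cf_det_sqr m : (P m.+1 * Q m - P m * Q m.+1) ^+ 2 = 1.
Proof.
elim: m => [|m IHm]; first by rewrite /cf_num /cf_den /=; ring.
rewrite cf_numSS cf_denSS -{}IHm.
have [_ /(_ m.+1 isT) eps1 _] := adm.
by case: eps1 => ->; ring.
Qed.

Lemma cf_segment_ge1 k m : (0 < k)%N -> 1 <= cf_segment a eps k m.
Proof.
have [a_gt0 eps1 a_eps] := adm.
elim: m k => [|m IHm] k k0 /=.
  by rewrite -[1]/(1%:~R) ler_int -gtz0_ge1 a_gt0.
have a1 : 1 <= (a k)%:~R :> rat by rewrite -[1]/(1%:~R) ler_int -gtz0_ge1 a_gt0.
have := IHm k.+1 isT; set X := cf_segment _ _ _ _ => X1.
have X0 : 0 < X by apply: lt_le_trans X1.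
have iX1 : X^-1 <= 1 by rewrite invf_le1.
have iX0 : 0 < X^-1 by rewrite invr_gt0.
have := a_eps k k0; case: (eps1 k.+1 isT) => ->; first by rewrite mul1r; lra.
by rewrite -(ler_int rat) intrD; lra.
Qed.

(** A convergent as a Möbius transform of its tail X. Positivity of the denominator is carried along
    the induction by X >= 1, and j = 0 gives the positivity of [cf_den]. *)
Lemma cf_tail m j (X := cf_segment a eps m.+1 j) :
  0 < (Q m.+1)%:~R * X + (eps m.+1)%:~R * (Q m)%:~R /\
  convergent a eps (m.+1 + j) * ((Q m.+1)%:~R * X + (eps m.+1)%:~R * (Q m)%:~R) =
  (P m.+1)%:~R * X + (eps m.+1)%:~R * (P m)%:~R.
Proof.
rewrite {}/X; elim: m j => [|m IHm] j.
  rewrite add1n /convergent /cf_num /cf_den /= mulr0 mul1r addr0 mulr1.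
  have X1 : 1 <= cf_segment a eps 1 j by exact: cf_segment_ge1.
  by split; [lra|field; lra].
have X1 : 1 <= cf_segment a eps m.+2 j by exact: cf_segment_ge1.
have := IHm j.+1; rewrite [cf_segment a eps m.+1 _]/= [in X in _ -> X]addSnnS.
move: X1; set X := cf_segment a eps m.+2 j => X1 [W0 cE].
have Xn0 : X != 0 by lra.
have e (Y : nat -> int) : Y m.+2 = a m.+1 * Y m.+1 + eps m.+1 * Y m ->
  (Y m.+2)%:~R * X + (eps m.+2)%:~R * (Y m.+1)%:~R =
  ((Y m.+1)%:~R * ((a m.+1)%:~R + (eps m.+2)%:~R / X) +
   (eps m.+1)%:~R * (Y m)%:~R) * X.
  by move=> ->; rewrite intrD !intrM; field.
rewrite (e Q)// (e P)//; split; first by rewrite mulr_gt0//; lra.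
by rewrite mulrA cE.
Qed.

Lemma cf_den_gt0 m : 0 < Q m.+1.
Proof.
case: m => [//|m]; have [+ _] := cf_tail m 0.
by rewrite cf_denSS /= -(ltr_int rat) intrD !intrM mulrC.
Qed.

Lemma convergentE m : convergent a eps m = (P m.+1)%:~R / (Q m.+1)%:~R.
Proof.
have Q0 : (Q m.+1)%:~R != 0 :> rat by rewrite intr_eq0 gt_eqF// cf_den_gt0.
apply: (mulIf Q0); rewrite divfK//.
case: m Q0 => [|m] Q0; first by rewrite /convergent /cf_num /cf_den /= mulr1.
have [_] := cf_tail m 0; rewrite addn0 /= => e.
by rewrite cf_denSS cf_numSS !intrD !intrM ![(a m.+1)%:~R * _]mulrC e.
Qed.

Lemma cf_coprime m : coprime `|P m.+1| `|Q m.+1|.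
Proof.
have : (P m.+1 * Q m - P m * Q m.+1) * (P m.+1 * Q m - P m * Q m.+1) = 1.
  by rewrite -expr2 cf_det_sqr.
set d := (_ - _) => dd.
change (coprimez (P m.+1) (Q m.+1)); apply/coprimezP.
exists (d * Q m, - d * P m) => /=; rewrite -[RHS]dd.
transitivity (d * (P m.+1 * Q m - P m * Q m.+1)); [by ring|by []].
Qed.

Lemma numq_convergent m : numq (convergent a eps m) = P m.+1.
Proof.
by rewrite convergentE coprimeq_num ?cf_coprime// gtr0_sg ?cf_den_gt0// mul1r.
Qed.

Lemma denq_convergent m : denq (convergent a eps m) = Q m.+1.
Proof.
rewrite convergentE coprimeq_den ?cf_coprime// gt_eqF ?cf_den_gt0//.
by rewrite gtr0_norm// cf_den_gt0.
Qed.

End Admissible.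
End Continuants.

(** * Uniqueness of the expansion with given convergents *)

Section Uniqueness.
Context {R : realType}.
Implicit Types (alpha : R) (a eps : nat -> int).

Definition cf_err alpha a eps (m : nat) : R :=
  (cf_num a eps m)%:~R - alpha * (cf_den a eps m)%:~R.

Lemma irrational_lin_indep alpha (p q : int) : irrational alpha ->
  p%:~R - alpha * q%:~R = 0 -> q = 0.
Proof.
move=> irr /eqP; rewrite subr_eq0 => /eqP e; apply/eqP/negP => /negP q0.
apply: irr; exists (p%:~R / q%:~R) => //.
by rewrite fmorph_div /= !ratr_int e mulfK// intr_eq0.
Qed.

Lemma approx_vec_convergent alpha a eps m : cf_admissible a eps ->
  approx_vec alpha (convergent a eps m) =
  ((cf_den a eps m.+1)%:~R, cf_err alpha a eps m.+1).
Proof. by move=> adm; rewrite /approx_vec numq_convergent// denq_convergent. Qed.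

Section Converges.
Context (alpha : R) (a eps : nat -> int).
Context (adm : cf_admissible a eps) (cvg : cf_converges a eps alpha).
Local Notation P := (cf_num a eps).
Local Notation Q := (cf_den a eps).

(** [cf_tail] rearranged into errors relative to the later convergent c, which tends to alpha as j
    grows. *)
Lemma cf_tail_real m j (c := ratr (convergent a eps (m.+1 + j)) : R) :
  ((P m.+1)%:~R - c * (Q m.+1)%:~R) * ratr (cf_segment a eps m.+1 j) =
  - (eps m.+1)%:~R * ((P m)%:~R - c * (Q m)%:~R).
Proof.
rewrite {}/c; have [_] := cf_tail adm m j.
move: (convergent _ _ _) (cf_segment _ _ _ _) => c X /(congr1 (@ratr R)).
rewrite !(rmorphM, rmorphD) /= !ratr_int => /eqP; rewrite -subr_eq0 => /eqP e.
by apply/eqP; rewrite -subr_eq0 -oppr_eq0 -e; apply/eqP; ring.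
Qed.

Lemma cf_shift_cvg m (p q : int) :
  (p%:~R - ratr (convergent a eps (m + j)) * q%:~R : R) @[j --> \oo] -->
  p%:~R - alpha * q%:~R.
Proof.
apply: cvgB; first exact: cvg_cst.
apply: cvgM; last exact: cvg_cst.
under eq_fun do rewrite addnC.
by have h := cvg; rewrite /cf_converges -(cvg_shiftn m) in h; exact: h.
Qed.

Lemma cf_err_le m : `|cf_err alpha a eps m.+1| <= `|cf_err alpha a eps m|.
Proof.
have c (p q : int) : `|p%:~R - ratr (convergent a eps (m.+1 + j)) * q%:~R : R|
    @[j --> \oo] --> `|p%:~R - alpha * q%:~R|.
  by apply: cvg_norm; exact: cf_shift_cvg.
have c1 := @c (P m.+1) (Q m.+1); have c0 := @c (P m) (Q m).
rewrite /cf_err -(cvg_lim _ c1)// -(cvg_lim _ c0)//.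
apply: ler_lim.
- by apply/cvg_ex; eexists; exact: c1.
- by apply/cvg_ex; eexists; exact: c0.
near=> j; have := cf_tail_real m j; set X := ratr (cf_segment _ _ _ _).
have X1 : 1 <= X by rewrite -(rmorph1 (@ratr R)) ler_rat cf_segment_ge1.
move: X X1 => X X1 /(congr1 (@Num.norm _ _)); rewrite !normrM normrN.
have [_ /(_ m.+1 isT) eps1 _] := adm.
have -> : `|(eps m.+1)%:~R| = 1 :> R.
  by case: eps1 => ->; rewrite ?normr1// normrN normr1.
rewrite mul1r => <-; apply: ler_peMr => //; exact: le_trans X1 (ler_norm _).
Unshelve. all: by end_near.
Qed.

(** By irrationality, equal absolute errors would make consecutive pairs (P, Q) equal, against the
    determinant, or their denominators opposite, against positivity. *)
Lemma cf_err_lt m : irrational alpha ->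
  `|cf_err alpha a eps m.+2| < `|cf_err alpha a eps m.+1|.
Proof.
move=> irr; rewrite lt_neqAle cf_err_le andbT; apply/eqP => /eqP.
have det := cf_det_sqr adm m.+1.
rewrite eqr_norm2 /cf_err => /orP[] /eqP e.
  have q : Q m.+2 - Q m.+1 = 0.
    apply: (@irrational_lin_indep alpha (P m.+2 - P m.+1)) => //.
    by rewrite !intrB; lra.
  have p : P m.+2 - P m.+1 = 0.
    apply/eqP; rewrite -(intr_eq0 R) intrB; move: e.
    have -> : Q m.+2 = Q m.+1 by lia.
    by move=> ?; apply/eqP; lra.
  have Qe : Q m.+2 = Q m.+1 by lia.
  have Pe : P m.+2 = P m.+1 by lia.
  by move: det; rewrite Qe Pe subrr expr0n.
have q : Q m.+2 + Q m.+1 = 0.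
  apply: (@irrational_lin_indep alpha (P m.+2 + P m.+1)) => //.
  move: e; move: (P m.+2) (P m.+1) (Q m.+2) (Q m.+1) => p2 p1 q2 q1 e.
  by rewrite !intrD; lra.
by have := cf_den_gt0 adm m.+1; have := cf_den_gt0 adm m; lia.
Qed.

End Converges.

(** If the sequences agree before m, then x m occurs in y, and y m in x, no earlier than m; if both
    occurred strictly later, f (x m) < f (y m) < f (x m). *)
Lemma decreasing_enum_unique (T : Type) (f : T -> R) (x y : nat -> T) :
  (forall m, f (x m.+1) < f (x m)) -> (forall m, f (y m.+1) < f (y m)) ->
  (forall z, (exists m, x m = z) <-> (exists m, y m = z)) ->
  forall m, x m = y m.
Proof.
move=> xd yd xy.
have dec (w : nat -> T) : (forall m, f (w m.+1) < f (w m)) ->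
    forall i j, (i < j)%N -> f (w j) < f (w i).
  move=> wd i; elim=> // j IHj; rewrite ltnS leq_eqVlt => /predU1P[->//|/IHj].
  exact: lt_trans.
elim/ltn_ind => m IHm.
have [j yj] : exists j, y j = x m by apply/xy; exists m.
have [i xi] : exists i, x i = y m by apply/xy; exists m.
have mj : (m <= j)%N.
  rewrite leqNgt; apply/negP => jm; have := dec _ xd _ _ jm.
  by rewrite (IHm _ jm) yj ltxx.
have mi : (m <= i)%N.
  rewrite leqNgt; apply/negP => im; have := dec _ yd _ _ im.
  by rewrite -(IHm _ im) xi ltxx.
move: mj mi; rewrite leq_eqVlt => /predU1P[mj _|mj].
  by rewrite -yj -mj.
rewrite leq_eqVlt => /predU1P[mi|mi]; first by rewrite -xi -mi.
have := dec _ yd _ _ mj; rewrite yj -xi => /lt_trans /(_ (dec _ xd _ _ mi)).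
by rewrite ltxx.
Qed.

(** Equal reduced fractions have equal numerators and denominators, and the recurrence is then a
    linear system for [a m.+1] and [eps m.+1] with determinant 1 or -1. *)
Lemma cf_convergents_inj a eps a' eps' :
  cf_admissible a eps -> cf_admissible a' eps' ->
  (forall m, convergent a eps m = convergent a' eps' m) -> same_cf a eps a' eps'.
Proof.
move=> adm adm' cE.
have nE m : cf_num a eps m = cf_num a' eps' m.
  by case: m => // m; rewrite -!numq_convergent// cE.
have dE m : cf_den a eps m = cf_den a' eps' m.
  by case: m => // m; rewrite -!denq_convergent// cE.
have main m : a m.+1 = a' m.+1 /\ eps m.+1 = eps' m.+1.
  have := nE m.+2; have := dE m.+2; rewrite !cf_numSS !cf_denSS -!nE -!dE.
  have := cf_det_sqr adm m.
  set p := cf_num a eps m; set p1 := cf_num a eps m.+1.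
  set q := cf_den a eps m; set q1 := cf_den a eps m.+1.
  move=> det hq hp.
  have dn0 : p1 * q - p * q1 != 0.
    by apply/eqP => d0; move: det; rewrite d0 expr0n.
  split; apply/eqP; rewrite -subr_eq0.
    have : (a m.+1 - a' m.+1) * (p1 * q - p * q1) == 0.
      apply/eqP; transitivity
        ((a m.+1 * p1 + eps m.+1 * p - (a' m.+1 * p1 + eps' m.+1 * p)) * q -
         (a m.+1 * q1 + eps m.+1 * q - (a' m.+1 * q1 + eps' m.+1 * q)) * p).
        by ring.
      by rewrite hp hq !subrr !mul0r subrr.
    by rewrite mulf_eq0 (negbTE dn0) orbF.
  have : (eps m.+1 - eps' m.+1) * (p1 * q - p * q1) == 0.
    apply/eqP; transitivity
      ((a m.+1 * q1 + eps m.+1 * q - (a' m.+1 * q1 + eps' m.+1 * q)) * p1 -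
       (a m.+1 * p1 + eps m.+1 * p - (a' m.+1 * p1 + eps' m.+1 * p)) * q1).
      by ring.
    by rewrite hp hq !subrr !mul0r subrr.
  by rewrite mulf_eq0 (negbTE dn0) orbF.
split=> [[|m]|[//|m] _]; [exact: (nE 1%N)|exact: (main m).1|exact: (main m).2].
Qed.

(* Semi-regularity makes the error |p_m - alpha q_m| strictly decreasing, which
   determines the order in which a given set of convergents is enumerated. *)
Lemma semi_regular_unique alpha a eps a' eps' : irrational alpha ->
  semi_regular a eps -> semi_regular a' eps' ->
  cf_converges a eps alpha -> cf_converges a' eps' alpha ->
  (forall x, (exists m, convergent a eps m = x) <->
             (exists m, convergent a' eps' m = x)) ->
  same_cf a eps a' eps'.
Proof.
move=> irr [a0 e0 ae _] [a0' e0' ae' _] cv cv' same.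
have adm : cf_admissible a eps by split.
have adm' : cf_admissible a' eps' by split.
apply: cf_convergents_inj => //.
apply: (@decreasing_enum_unique _ (fun x => `|(approx_vec alpha x).2|)) => // m;
  rewrite !approx_vec_convergent//; exact: cf_err_lt.
Qed.

End Uniqueness.

(** * The regular continued fraction *)

Section RegularContinuedFraction.
Context {R : realType}.

(** The complete quotients of alpha; their integer and fractional parts are b_n and u_n. *)
Fixpoint rcf_tail (alpha : R) (n : nat) : R :=
  if n is n'.+1 then
    (rcf_tail alpha n' - (Num.floor (rcf_tail alpha n'))%:~R)^-1
  else alpha.

Definition rcf_digit (alpha : R) (n : nat) : int := Num.floor (rcf_tail alpha n).

Definition rcf_frac (alpha : R) (n : nat) : R :=
  rcf_tail alpha n - (rcf_digit alpha n)%:~R.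

Context (alpha : R) (irr : irrational alpha).
Local Notation x := (rcf_tail alpha).
Local Notation b := (rcf_digit alpha).
Local Notation w := (rcf_frac alpha).
Local Notation P := (cf_num b (fun=> 1)).
Local Notation Q := (cf_den b (fun=> 1)).
Local Notation D := (cf_err alpha b (fun=> 1)).

Lemma irrational_frac_inv (y : R) (m : int) : irrational y ->
  irrational (y - m%:~R)^-1.
Proof.
move=> irry [q _ qE]; apply: irry; exists (m%:~R + q^-1) => //.
by rewrite rmorphD fmorphV /= ratr_int qE invrK addrC subrK.
Qed.

Lemma rcf_tail_irrational n : irrational (x n).
Proof. by elim: n => //= n; exact: irrational_frac_inv. Qed.

Lemma rcf_frac_itv n : 0 < w n < 1.
Proof.
have := floor_itv (x n); rewrite -/(b n) intrD => /andP[xb xb1].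
rewrite /rcf_frac subr_gt0 ltrBlDl xb1 andbT lt_neqAle xb andbT.
apply/eqP => xE; apply: (@rcf_tail_irrational n).
by exists (b n)%:~R => //; rewrite ratr_int.
Qed.

Lemma rcf_frac_gt0 n : 0 < w n. Proof. by have /andP[] := rcf_frac_itv n. Qed.

Lemma rcf_frac_lt1 n : w n < 1. Proof. by have /andP[] := rcf_frac_itv n. Qed.

Lemma rcf_frac_irrational n : irrational (w n).
Proof.
have h := @irrational_frac_inv _ (b n) (@rcf_tail_irrational n).
by move=> [q _ qE]; apply: h; exists q^-1 => //; rewrite fmorphV /= qE.
Qed.

Lemma rcf_fracS n : w n.+1 = (w n)^-1 - (b n.+1)%:~R. Proof. by []. Qed.

Lemma rcf_digitS n : b n.+1 = Num.floor (w n)^-1. Proof. by []. Qed.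

Lemma rcf_digit_ge1 n : (0 < n)%N -> 1 <= b n.
Proof.
case: n => // n _; rewrite rcf_digitS floor_ge_int invf_ge1 ?rcf_frac_gt0//.
exact/ltW/rcf_frac_lt1.
Qed.

Lemma rcf_admissible : cf_admissible b (fun=> 1).
Proof.
split=> // [m m0|m m0|m m0]; first exact: lt_le_trans (rcf_digit_ge1 m0).
  by left.
by have := rcf_digit_ge1 m0; lia.
Qed.

Lemma rcf_numSS n : P n.+2 = b n.+1 * P n.+1 + P n.
Proof. by rewrite cf_numSS mul1r. Qed.

Lemma rcf_denSS n : Q n.+2 = b n.+1 * Q n.+1 + Q n.
Proof. by rewrite cf_denSS mul1r. Qed.

Lemma rcf_errSS n : D n.+2 = (b n.+1)%:~R * D n.+1 + D n.
Proof. by rewrite /cf_err rcf_numSS rcf_denSS !intrD !intrM; ring. Qed.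

(** With the shifted index, [D n] is the error of the convergent n - 1. Thus u_n is a ratio of
    consecutive errors, as v_n is a ratio of consecutive denominators. *)
Lemma rcf_errS n : D n.+1 = - w n * D n.
Proof.
elim: n => [|n IHn].
  by rewrite /cf_err /cf_num /cf_den /= /rcf_frac /=; ring.
have wn0 : w n != 0 by rewrite gt_eqF ?rcf_frac_gt0.
rewrite rcf_errSS rcf_fracS.
have -> : D n = - (w n)^-1 * D n.+1 by rewrite IHn mulrA mulrNN mulVf ?mul1r.
by ring.
Qed.

Lemma rcf_err_neq0 n : D n != 0.
Proof.
elim: n => [|n IHn]; first by rewrite /cf_err /cf_num /cf_den /= mulr0 subr0 oner_eq0.
by rewrite rcf_errS mulf_neq0// oppr_eq0 gt_eqF ?rcf_frac_gt0.
Qed.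

Lemma rcf_err_norm n : `|D n.+1| = w n * `|D n|.
Proof. by rewrite rcf_errS normrM normrN (gtr0_norm (rcf_frac_gt0 n)). Qed.

Lemma rcf_den_gt0 n : 0 < Q n.+1.
Proof. exact/cf_den_gt0/rcf_admissible. Qed.

Lemma rcf_den_ge0 n : 0 <= Q n.
Proof. by case: n => // n; exact/ltW/rcf_den_gt0. Qed.

Lemma rcf_den_le n : Q n <= Q n.+1.
Proof.
case: n => // n; rewrite rcf_denSS.
by have := rcf_digit_ge1 (ltn0Sn n); have := rcf_den_ge0 n; have := rcf_den_gt0 n; nia.
Qed.

Lemma rcf_den_ge n : n%:Z <= Q n.+1.
Proof.
elim: n => [//|[|n] IHn]; first by have := rcf_den_gt0 1; lia.
rewrite rcf_denSS.
have := rcf_digit_ge1 (ltn0Sn n.+1).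
by have := rcf_den_gt0 n; have := rcf_den_gt0 n.+1; nia.
Qed.

Lemma rcf_err_le1 n : `|D n| <= 1.
Proof.
elim: n => [|n IHn]; first by rewrite /cf_err /cf_num /cf_den /= mulr0 subr0 normr1.
by rewrite rcf_err_norm mulr_ile1// ltW ?rcf_frac_gt0 ?rcf_frac_lt1.
Qed.

Lemma rcf_converges : cf_converges b (fun=> 1) alpha.
Proof.
apply/cvgrPdist_le => e e0.
near=> n; rewrite convergentE; last exact: rcf_admissible.
have Q0 : 0 < (Q n.+1)%:~R :> R by rewrite ltr0z rcf_den_gt0.
rewrite fmorph_div /= !ratr_int distrC.
have -> : (P n.+1)%:~R / (Q n.+1)%:~R - alpha = D n.+1 / (Q n.+1)%:~R :> R.
  by rewrite /cf_err; field; rewrite gt_eqF.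
rewrite normrM normfV (gtr0_norm Q0) ler_pdivrMr//.
apply: le_trans (rcf_err_le1 _) _; rewrite mulrC -ler_pdivrMr// div1r.
apply: (@le_trans _ _ n%:R); last by rewrite -[n%:R]/(n%:~R) ler_int rcf_den_ge.
by near: n; exact: nbhs_infty_ger.
Unshelve. all: by end_near.
Qed.

Lemma rcf_is_regular : is_regular_cf alpha b.
Proof. by split => //; [exact: rcf_digit_ge1|exact: rcf_converges]. Qed.

Lemma rcf_uE n : rcf_u alpha b n = w n.
Proof.
case: n => // n; rewrite /rcf_u; set m := n.+1.
have adm := rcf_admissible.
have cv p q := @cf_shift_cvg _ _ _ _ rcf_converges m.+1 p q.
have Dm0 : (P m)%:~R - alpha * (Q m)%:~R != 0 := rcf_err_neq0 m.
apply/cvg_lim => //.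
have -> : w m = - ((P m.+1)%:~R - alpha * (Q m.+1)%:~R) /
    ((P m)%:~R - alpha * (Q m)%:~R).
  apply: (mulIf Dm0); rewrite divfK//.
  by have := rcf_errS m; rewrite /cf_err => ->; ring.
have -> : (fun j => (ratr (cf_segment b (fun=> 1) m.+1 j) : R)^-1) =
   (fun j => - ((P m.+1)%:~R - ratr (convergent b (fun=> 1) (m.+1 + j)) * (Q m.+1)%:~R)
     / ((P m)%:~R - ratr (convergent b (fun=> 1) (m.+1 + j)) * (Q m)%:~R)).
  apply/funext => j; have := @cf_tail_real R _ _ adm m j; cbv zeta.
  have X1 : 1 <= ratr (cf_segment b (fun=> 1) m.+1 j) :> R.
    by rewrite -(rmorph1 (@ratr R)) ler_rat cf_segment_ge1.
  move: (ratr (cf_segment _ _ _ _)) X1 => X X1.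
  move: (ratr (convergent _ _ _)) => c e.
  have Xn0 : X != 0 by lra.
  have cn0 : (P m)%:~R - c * (Q m)%:~R != 0.
    apply/eqP => c0; move: e; rewrite c0 mulr0 => /eqP.
    rewrite mulf_eq0 (negbTE Xn0) orbF => /eqP c1.
    have := cf_det_sqr adm m; have -> : P m.+1 * Q m - P m * Q m.+1 = 0.
      apply/eqP; rewrite -(intr_eq0 R) intrB !intrM.
      have -> : (P m.+1)%:~R = c * (Q m.+1)%:~R by lra.
      have -> : (P m)%:~R = c * (Q m)%:~R by lra.
      by apply/eqP; ring.
    by rewrite expr0n.
  apply: (mulIf cn0); rewrite divfK//; apply: (mulIf Xn0).
  rewrite mulNr e; field.
  by [].
apply: cvgM; first by apply: cvgN; exact: cv.
by apply: cvgV => //; exact: cv.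
Qed.

Lemma rcf_vE n : rcf_v b n = (Q n)%:~R / (Q n.+1)%:~R :> R.
Proof.
elim: n => [|n IHn]; first by rewrite /= /cf_den /= mul0r.
have Q1 := rcf_den_gt0 n.
have Q2 := rcf_den_gt0 n.+1.
rewrite /= IHn rcf_denSS; rewrite rcf_denSS in Q2; rewrite intrD intrM.
rewrite -(ltr_int R) intrD intrM in Q2; rewrite -(ltr_int R) in Q1.
by field; rewrite ?gt_eqF.
Qed.

End RegularContinuedFraction.

(** * Best approximations *)

Section LocalMinimum.
Context {R : realType}.

Lemma intr_lt_succ (m n : int) : m < n -> m%:~R + 1 <= n%:~R :> R.
Proof. by rewrite -lezD1 -(ler_int R) intrD. Qed.

Lemma intr_lt0 (m : int) : m < 0 -> m%:~R <= -1 :> R.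
Proof. by move=> /intr_lt_succ; rewrite mulr0z -lerBrDr sub0r. Qed.

Lemma intr_gt0 (m : int) : 0 < m -> 1 <= m%:~R :> R.
Proof. by move=> /intr_lt_succ; rewrite mulr0z add0r. Qed.

Context (F : R * R -> R) (Fnorm : is_norm F) (Fsym : strongly_symmetric F).

Lemma norm_min_continuous (f1 f2 g1 g2 : R -> R) :
  continuous f1 -> continuous f2 -> continuous g1 -> continuous g2 ->
  continuous (fun t => Num.min (F (f1 t, f2 t)) (F (g1 t, g2 t))).
Proof.
move=> cf1 cf2 cg1 cg2 t.
by apply: continuous_min; apply: (norm_comp_continuous Fnorm Fsym).
Qed.

(* If the conclusion fails, continuity gives t and indices i in {-1, 0} and
   j in {b, b + 1} for which both vectors are at most as long as (1, t u).
   Their difference is j - i times (1, t u) and the triangle inequality is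
   strict, so j - i < 2; this leaves i = 0 and j = b = 1. *)
Lemma local_min_ex (u v : R) (b : int) : 0 < v <= 1 -> 1 <= b ->
  0 < u < 1 -> b%:~R * u < 1 -> 1 < (b%:~R + 1) * u ->
  (b = 1 -> ~ shadowed F (u, v)) ->
  exists t : R, [/\ 0 < t, F (1, t * u) < F (v, t),
    F (1, t * u) < F (1 - v, t * (1 + u)),
    F (1, t * u) < F (v + b%:~R, t * (1 - b%:~R * u)) &
    F (1, t * u) < F (v + b%:~R + 1, t * ((b%:~R + 1) * u - 1))].
Proof.
move=> /andP[v0 v1] b1 /andP[u0 u1] bu1 bu2 nsh.
have B1 : 1 <= b%:~R :> R by exact: intr_gt0.
set B : R := b%:~R in bu1 bu2 B1 *.
apply/not_existsP => none.
have d0 : 0 < (B + 1) * u - 1 by lra.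
(* At [a], the candidate i = -1 has length at most 1 - v + v = 1; at [e], the candidate j = b has
   length at most e u. *)
pose a := v / (1 + u).
pose e := a + (v + B) / ((B + 1) * u - 1).
have a0 : 0 < a by rewrite divr_gt0//; lra.
have ae : a <= e by rewrite /e lerDl divr_ge0//; lra.
have cm : continuous (fun t : R => F (1, t * u)).
  apply: norm_comp_continuous => // t; first exact: cvg_cst.
  by apply: cvgM; [exact: cvg_id|exact: cvg_cst].
have scal (c : R) : continuous (fun t : R => t * c).
  by move=> t; apply: cvgM; [exact: cvg_id|exact: cvg_cst].
have cst (c : R) : continuous (fun _ : R => c) by move=> t; exact: cvg_cst.
have [||||||t [at_ ft gt]] := @both_ge0_IVT R
  (fun t => F (1, t * u) - Num.min (F (v, t)) (F (1 - v, t * (1 + u))))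
  (fun t => F (1, t * u) - Num.min (F (v + B, t * (1 - B * u)))
                                   (F (v + B + 1, t * ((B + 1) * u - 1)))) a e.
- exact: ae.
- move=> t; apply: cvgB; first exact: cm.
  apply: (@norm_min_continuous (fun=> v) id (fun=> 1 - v)) => // s.
  exact: cvg_id.
- move=> t; apply: cvgB; first exact: cm.
  exact: (@norm_min_continuous (fun=> v + B) (fun t => t * (1 - B * u))
    (fun=> v + B + 1) (fun t => t * ((B + 1) * u - 1))).
- rewrite subr_ge0 ge_min; apply/orP; right.
  apply: (@le_trans _ _ 1); last first.
    by have := norm_ge_l Fnorm Fsym 1 (a * u); rewrite normr1.
  have := norm_le_sum Fnorm Fsym (1 - v) (a * (1 + u)).
  have -> : a * (1 + u) = v by rewrite /a divfK// gt_eqF//; lra.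
  by rewrite !ger0_norm; lra.
- rewrite subr_ge0 ge_min; apply/orP; left.
  have e0 : 0 < e by apply: lt_le_trans ae.
  have := norm_ge_r Fnorm Fsym 1 (e * u).
  have := norm_le_sum Fnorm Fsym (v + B) (e * (1 - B * u)).
  rewrite !ger0_norm ?mulr_ge0//; try lra.
  have : v + B <= e * ((B + 1) * u - 1).
    rewrite /e mulrDl divfK ?gt_eqF// lerDr mulr_ge0//; lra.
  lra.
- move=> t at_; have t0 : 0 < t by apply: lt_le_trans at_.
  rewrite !subr_ge0 !ge_min; apply/orP; apply/negPn/negP.
  rewrite !negb_or -!ltNge => /andP[/andP[h1 h2] /andP[h3 h4]].
  by apply: (none t).
have t0 : 0 < t by apply: lt_le_trans at_.
move: ft gt; rewrite !subr_ge0; set m := F (1, t * u).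
have m0 : 0 < m.
  by apply: lt_le_trans (norm_ge_l Fnorm Fsym _ _); rewrite normr1.
have mul c : 0 <= c -> F (c, t * (c * u)) = c * m.
  by move=> c0; rewrite /m -(norm_pscale Fnorm)// mulr1 mulrCA.
have tBu : 0 < t * (1 - B * u) by rewrite mulr_gt0//; lra.
rewrite !ge_min => /orP[le_l|le_l] /orP[le_r|le_r].
- have := @norm_add_lt _ F Fnorm Fsym (- v) t (v + B) (- (t * (1 - B * u))) m.
  rewrite norm_Nl// norm_Nr// => /(_ t0) h.
  have {h} : F (- v + (v + B), t - t * (1 - B * u)) < 2 * m.
    by apply: h => //; rewrite ?oppr_lt0// normrN !gtr0_norm; lra.
  have -> : - v + (v + B) = B by ring.
  have -> : t - t * (1 - B * u) = t * (B * u) by ring.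
  rewrite mul; last lra.
  rewrite ltr_pM2r// => B2.
  have bE : b = 1 by apply/eqP; rewrite eq_le b1 andbT -ltzD1 -(ltr_int R).
  have BE : B = 1 by rewrite /B bE.
  rewrite BE mul1r addrC in le_r; rewrite BE in bu2.
  apply: nsh => //; apply: (@shadowed_of_ex _ _ Fnorm Fsym _ _ t) => //.
    by rewrite u1 andbT; lra.
  by rewrite v1 ltW.
- have := @norm_add_lt _ _ (is_norm_swap Fnorm) (strongly_symmetric_swap Fsym)
    (t * ((B + 1) * u - 1)) (v + B + 1) t (- v) m.
  rewrite /swap_norm /= norm_Nl// => h.
  have {h} : F (v + B + 1 - v, t * ((B + 1) * u - 1) + t) < 2 * m.
    apply: h => //; try lra.
    rewrite (gtr0_norm t0) gtr0_norm ?mulr_gt0//.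
    by rewrite gtr_pMr//; lra.
  have -> : v + B + 1 - v = B + 1 by ring.
  have -> : t * ((B + 1) * u - 1) + t = t * ((B + 1) * u) by ring.
  rewrite mul; last lra.
  by rewrite ltr_pM2r//; lra.
- have := @norm_add_lt _ F Fnorm Fsym (1 - v) (t * (1 + u)) (v + B)
    (- (t * (1 - B * u))) m.
  rewrite norm_Nr// => h.
  have {h} : F (1 - v + (v + B), t * (1 + u) - t * (1 - B * u)) < 2 * m.
    apply: h => //; rewrite ?oppr_lt0// ?mulr_gt0//; try lra.
    by rewrite !ger0_norm; lra.
  have -> : 1 - v + (v + B) = B + 1 by ring.
  have -> : t * (1 + u) - t * (1 - B * u) = t * ((B + 1) * u) by ring.
  rewrite mul; last lra.
  by rewrite ltr_pM2r//; lra.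
(* The difference is B + 2 >= 3 times (1, t u), so the ordinary triangle inequality suffices. *)
- have := norm_triangle Fnorm (1 - v) (t * (1 + u)) (v + B + 1)
    (t * ((B + 1) * u - 1)).
  have -> : 1 - v + (v + B + 1) = B + 2 by ring.
  have -> : t * (1 + u) + t * ((B + 1) * u - 1) = t * ((B + 2) * u) by ring.
  rewrite mul; last lra.
  by nra.
Qed.

Lemma int_round (x y : int) : x != 0 -> exists j : int, 2 * `|y - j * x| <= `|x|.
Proof.
move=> x0; have := divz_eq y x; have := modz_ge0 y x0; have := ltz_mod y x0.
set q := (y %/ x)%Z; set r := (y %% x)%Z => rx r0 ->.
have [r2|r2] := leP (2 * r) `|x|.
  by exists q; rewrite addrAC subrr add0r ger0_norm.
exists (q + Num.sg x).
have -> : q * x + r - (q + Num.sg x) * x = r - `|x| by rewrite normrEsg; ring.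
by rewrite ler0_norm; lia.
Qed.

(** By monotonicity the four vectors of [local_min_ex] control all e_(n-1) + j e_n. A general x
    e_(n-1) + y e_n is x times one of these, with j nearest to y / x, up to at most |x| / 2 copies
    of e_n. This suffices for |x| >= 2, and for |x| = 1 the rounding is exact. *)
Lemma lattice_min_ex (u v : R) (b : int) : 0 < v <= 1 -> 1 <= b ->
  0 < u < 1 -> b%:~R * u < 1 -> 1 < (b%:~R + 1) * u ->
  (b = 1 -> ~ shadowed F (u, v)) ->
  exists2 t, 0 < t & forall x y : int, x != 0 ->
    F (1, t * u) < F (x%:~R * v + y%:~R, t * (x%:~R - y%:~R * u)).
Proof.
move=> v01 b1 u01 bu1 bu2 nsh.
have [t [t0 h0 hN1 hb hb1]] := local_min_ex v01 b1 u01 bu1 bu2 nsh.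
move: v01 u01 => /andP[v0 v1] /andP[u0 u1].
exists t => //; set m := F (1, t * u) in h0 hN1 hb hb1 *.
have m0 : 0 < m.
  by apply: lt_le_trans (norm_ge_l Fnorm Fsym _ _); rewrite normr1.
have B1 : 1 <= b%:~R :> R by exact: intr_gt0.
have main (j : int) : m < F (v + j%:~R, t * (1 - j%:~R * u)).
  have [j0|j0] := ltP j 0.
    have J := intr_lt0 j0.
    apply: lt_le_trans hN1 _; apply: norm_le => //.
      by rewrite ger0_norm ?ler0_norm; lra.
    rewrite !normrM ler_wpM2l// !ger0_norm; nra.
  have [jE|jN0] := eqVneq j 0; first by rewrite jE addr0 mul0r subr0 mulr1.
  have [bj|jb] := ltP b j.
    have J := intr_lt_succ bj.
    apply: lt_le_trans hb1 _; apply: norm_le => //.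
      by rewrite !ger0_norm; lra.
    rewrite !normrM ler_wpM2l// ger0_norm ?ler0_norm; nra.
  have [->//|jnb] := eqVneq j b.
  have J1 : 1 <= j%:~R :> R by apply: intr_gt0; rewrite lt_neqAle eq_sym jN0.
  have Jb : j%:~R + 1 <= b%:~R :> R by apply: intr_lt_succ; rewrite lt_neqAle jnb.
  have ju : j%:~R * u + u < 1 by nra.
  apply: norm_lt => //; first by rewrite normr1 gtr0_norm; lra.
  by rewrite !normrM ltr_pM2l ?normr_gt0 ?gt_eqF// !gtr0_norm; lra.
move=> x y x0; have [j jxy] := int_round y x0.
set X : R := x%:~R; set Y : R := y%:~R; set J : R := j%:~R.
have tri : `|X| * F (v + J, t * (1 - J * u)) <=
    F (X * v + Y, t * (X - Y * u)) + `|Y - J * X| * m.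
  rewrite -(norm_scale Fnorm) /m -(norm_scale Fnorm).
  have := norm_triangle Fnorm (X * v + Y) (t * (X - Y * u))
    (- ((Y - J * X) * 1)) (- (- ((Y - J * X) * (t * u)))).
  rewrite !norm_Nr// !norm_Nl// => h; apply: le_trans h.
  by rewrite le_eqVlt; apply/orP; left; apply/eqP; congr (F (_, _)); ring.
have jxyR : 2 * `|Y - J * X| <= `|X|.
  by move: jxy; rewrite -(ler_int R) intrM !intr_norm intrB intrM.
have Mj := main j; rewrite -/J in Mj.
have [x1|x1] := eqVneq `|x| 1.
  have yE : y - j * x = 0 by move: jxy; rewrite x1; clear; lia.
  have YE : Y - J * X = 0 by rewrite /X /Y /J -intrM -intrB yE.
  have XE : `|X| = 1 by rewrite /X -intr_norm x1.
  by rewrite YE normr0 XE mul1r mul0r addr0 in tri; apply: lt_le_trans tri.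
have X2 : 2 <= `|X|.
  have : 1 < `|x| by rewrite lt_neqAle eq_sym x1 -gtz0_ge1 normr_gt0.
  by move=> /intr_lt_succ; rewrite intr_norm.
nra.
Qed.

End LocalMinimum.

(** * Best approximations are the convergents outside the area *)

Section BestApproximation.
Context {R : realType}.
Context (F : R * R -> R) (Fnorm : is_norm F) (Fsym : strongly_symmetric F).
Context (alpha : R) (irr : irrational alpha).
Local Notation b := (rcf_digit alpha).
Local Notation w := (rcf_frac alpha).
Local Notation P := (cf_num b (fun=> 1)).
Local Notation Q := (cf_den b (fun=> 1)).
Local Notation D := (cf_err alpha b (fun=> 1)).
Local Notation cv := (convergent b (fun=> 1)).
Local Notation adm := (rcf_admissible irr).

Definition rcf_point (n : nat) : R * R := (w n, (Q n)%:~R / (Q n.+1)%:~R).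

Lemma rcf_lattice n (p q : int) : exists x y : int,
  p = x * P n + y * P n.+1 /\ q = x * Q n + y * Q n.+1.
Proof.
have := cf_det_sqr adm n.
move: (P n) (P n.+1) (Q n) (Q n.+1) => p0 p1 q0 q1 d2.
exists ((p1 * q0 - p0 * q1) * (p1 * q - q1 * p)),
  ((p1 * q0 - p0 * q1) * (p * q0 - q * p0)).
by split; [rewrite -[LHS]mul1r -d2; ring|rewrite -[LHS]mul1r -d2; ring].
Qed.

Lemma rcf_lattice_err n (x y : int) :
  (x * P n + y * P n.+1)%:~R - alpha * (x * Q n + y * Q n.+1)%:~R =
  D n * (x%:~R - y%:~R * w n).
Proof.
transitivity (x%:~R * D n + y%:~R * D n.+1).
  by rewrite /cf_err; ring.
by rewrite rcf_errS//; ring.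
Qed.

(** The bounds on q force y = 0 or opposite signs for x and y; the errors of consecutive convergents
    also alternate, so the contributions add up. *)
Lemma rcf_best_law n (p q : int) : 0 < q -> q < Q n.+1 ->
  `|D n| <= `|p%:~R - alpha * q%:~R|.
Proof.
have [x [y [-> qE]]] := rcf_lattice n p q; rewrite {1 2}qE => q0 q1.
have Qn := rcf_den_ge0 irr n; have Qn1 := rcf_den_gt0 irr n.
rewrite qE rcf_lattice_err normrM ler_peMr//.
have w0 := rcf_frac_gt0 irr n.
have [y0|y0|y0] := ltgtP y 0.
- have x1 : 0 < x by nia.
  have {}x1 : 1 <= x%:~R :> R by apply: intr_gt0.
  have {}y0 : y%:~R <= -1 :> R by apply: intr_lt0.
  by apply: le_trans (ler_norm _); nra.
- have x1 : x < 0 by nia.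
  have {}x1 : x%:~R <= -1 :> R by apply: intr_lt0.
  have {}y0 : 1 <= y%:~R :> R by apply: intr_gt0.
  by rewrite ler0_norm; nra.
- rewrite y0 mul0r subr0 -intr_norm intr_gt0// normr_gt0.
  by apply/eqP => x0; move: q0; rewrite x0 y0 !mul0r.
Qed.

(** Translation to the normalised vectors: the scaling t of the norm becomes t^2 |D n| / Q (n+1). *)
Lemma rescale_lattice n (t : R) (x y : int) : 0 < t ->
  rescale F t ((x * Q n + y * Q n.+1)%:~R,
    (x * P n + y * P n.+1)%:~R - alpha * (x * Q n + y * Q n.+1)%:~R) =
  (Q n.+1)%:~R / t * F (x%:~R * (rcf_point n).2 + y%:~R,
    t ^+ 2 * `|D n| / (Q n.+1)%:~R * (x%:~R - y%:~R * (rcf_point n).1)).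
Proof.
move=> t0; have Q0 : 0 < (Q n.+1)%:~R :> R by rewrite ltr0z rcf_den_gt0.
rewrite -(norm_pscale Fnorm) ?divr_ge0 ?ltW// /rescale /= rcf_lattice_err.
rewrite norm_abs// [RHS]norm_abs//; congr (F (_, _)).
  congr (`| _ |); rewrite intrD !intrM; field.
  by rewrite !gt_eqF.
rewrite [LHS]normrM [`|D n * _|]normrM [RHS]normrM (gtr0_norm t0).
rewrite [`|_ / t|]gtr0_norm ?divr_gt0//.
rewrite [`|_ * (_ - _)|]normrM [`|_ / (Q _)%:~R|]ger0_norm; last first.
  by rewrite divr_ge0 ?(ltW Q0)// mulr_ge0// exprn_ge0// ltW.
by field; rewrite !gt_eqF.
Qed.

Lemma approx_vec_cv n : approx_vec alpha (cv n) =
  ((0 * Q n + 1 * Q n.+1)%:~R,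
   (0 * P n + 1 * P n.+1)%:~R - alpha * (0 * Q n + 1 * Q n.+1)%:~R).
Proof. by rewrite approx_vec_convergent; [rewrite !mul0r !add0r !mul1r|exact: adm]. Qed.

Lemma cv_inj_step n : cv n.+1 != cv n.
Proof.
apply/eqP => e; have := cf_err_lt adm (rcf_converges irr) n irr.
have := congr1 (fun x => (approx_vec alpha x).2) e.
by rewrite !approx_vec_convergent; [|exact: adm..] => /= ->; rewrite ltxx.
Qed.

Lemma rcf_point2_itv n : 0 <= (rcf_point n).2 <= 1.
Proof.
have Q0 : 0 < (Q n.+1)%:~R :> R by rewrite ltr0z rcf_den_gt0.
rewrite /= divr_ge0 ?(ltW Q0)//; last by rewrite ler0z rcf_den_ge0.
by rewrite ler_pdivrMr// mul1r ler_int rcf_den_le.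
Qed.

Lemma rcf_digit1 n : 2^-1 < w n -> b n.+1 = 1.
Proof.
move=> w2; have w0 := rcf_frac_gt0 irr n; have w1 := rcf_frac_lt1 irr n.
rewrite rcf_digitS; apply: floor_def; rewrite ltW ?invf_gt1//=.
by rewrite -[ltRHS]invrK ltf_pV2// posrE invr_gt0.
Qed.

Lemma best_approximation_rcf x : best_approximation F alpha x ->
  exists2 n, cv n = x & ~ shadow_area F (rcf_point n).
Proof.
move=> [t t1 best]; have t0 : 0 < t by apply: lt_trans t1.
have [n Qn nQ] : exists2 n, Q n.+1 <= denq x & denq x < Q n.+2.
  have ex : exists n, denq x < Q n.+2.
    exists `|denq x|%N; apply: lt_le_trans (rcf_den_ge irr _).
    by have := denq_gt0 x; lia.
  have [n nQ nmin] := ex_minnP ex; exists n => //.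
  case: n nmin {nQ} => [_|n nmin]; first by have := denq_gt0 x; rewrite /cf_den /=; lia.
  by rewrite leNgt; apply/negP => /nmin; rewrite ltnn.
have cvx : cv n = x.
  (* Otherwise [cv n] would be a competitor of x with no larger denominator and, by [rcf_best_law],
     no larger error. *)
  apply/eqP/negPn/negP => /best; apply/negP; rewrite -leNgt.
  rewrite approx_vec_convergent; last exact: adm.
  rewrite /rescale /=; apply: norm_le => //; rewrite !normrM ler_wpM2l//.
    by rewrite -!intr_norm ler_int !gtr0_norm ?denq_gt0 ?rcf_den_gt0.
  by apply: rcf_best_law; rewrite ?denq_gt0.
exists n => // -[/= /andP[w2 w1] v01 sh]; subst x.
have Q0 : 0 < (Q n.+1)%:~R :> R by rewrite ltr0z rcf_den_gt0.
have c0 : 0 < (Q n.+1)%:~R / t by rewrite divr_gt0.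
have right_le : ~ F (1 + (rcf_point n).2, t ^+ 2 * `|D n| / (Q n.+1)%:~R * (1 - w n)) <=
    F (1, t ^+ 2 * `|D n| / (Q n.+1)%:~R * w n).
  have /best := cv_inj_step n; rewrite approx_vec_cv rescale_lattice//.
  have -> : approx_vec alpha (cv n.+1) = ((1 * Q n + 1 * Q n.+1)%:~R,
     (1 * P n + 1 * P n.+1)%:~R - alpha * (1 * Q n + 1 * Q n.+1)%:~R).
    rewrite approx_vec_convergent; last exact: adm.
    rewrite /cf_err rcf_numSS rcf_denSS rcf_digit1// !mul1r.
    by rewrite ![_ n.+1 + _ n]addrC.
  rewrite rescale_lattice// ltr_pM2l// mul0r add0r !mul1r sub0r mulrN norm_Nr//.
  by rewrite leNgt addrC => ->.
have s0 : 0 < t ^+ 2 * `|D n| / (Q n.+1)%:~R.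
  by rewrite divr_gt0// mulr_gt0 ?exprn_gt0// normr_gt0 rcf_err_neq0.
case: (sh _ s0) => //= left_le.
(* For n = 0 the left neighbour is the formal convergent 1/0, which is no competitor; there v_0 = 0
   and u_0 > 1/2 contradict [right_le] directly. *)
case: n Qn nQ best w2 w1 v01 sh Q0 c0 right_le s0 left_le =>
    [|n] Qn nQ best w2 w1 v01 sh Q0 c0 right_le s0 left_le.
  apply: right_le; rewrite [(rcf_point 0).2]/= /cf_den /= mul0r addr0.
  by apply: norm_le_r => //; rewrite ?mulr_ge0 ?ler_pM2l// ?(ltW s0)//; lra.
have /best : cv n != cv n.+1 by rewrite eq_sym cv_inj_step.
rewrite approx_vec_cv rescale_lattice//.
have -> : approx_vec alpha (cv n) = ((1 * Q n.+1 + 0 * Q n.+2)%:~R,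
   (1 * P n.+1 + 0 * P n.+2)%:~R - alpha * (1 * Q n.+1 + 0 * Q n.+2)%:~R).
  by rewrite approx_vec_convergent; [rewrite !mul0r !addr0 !mul1r|exact: adm].
rewrite rescale_lattice// ltr_pM2l// !mul0r !add0r addr0 subr0 !mul1r mulr1.
by rewrite mulrN norm_Nr// ltNge left_le.
Qed.

(** Treated apart because v_0 = 0. Being outside the area forces u_0 < 1/2, so b_0 is the integer
    nearest to alpha. *)
Lemma rcf_best_approximation0 : ~ shadow_area F (rcf_point 0) ->
  best_approximation F alpha (cv 0).
Proof.
move=> nS; have w0 := rcf_frac_gt0 irr 0; have w1 := rcf_frac_lt1 irr 0.
have w2 : w 0 < 2^-1.
  rewrite ltNge le_eqVlt; apply/negP => /predU1P[e|w2].
    apply: (@rcf_frac_irrational _ _ irr 0); exists 2^-1 => //.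
    by rewrite fmorphV rmorph_nat.
  apply: nS; split; rewrite /= ?w2 ?w1//; first by rewrite /cf_den /= mul0r ler01 lexx.
  move=> t t0; right; rewrite /= /cf_den /= mul0r addr0.
  by apply: norm_le_r => //; rewrite ?mulr_ge0 ?ler_pM2l// ?(ltW t0)//; lra.
(* With t^2 = 2 the errors are doubled relative to the denominators: F(1, 2 u_0) < 2 handles
   denominators at least 2, and 2 (1 - u_0) > 1 makes the other integers strictly worse. *)
exists (Num.sqrt 2); first by rewrite -[ltLHS]sqrtr1 ltr_sqrt ?ltr1n.
set t := Num.sqrt 2.
have t0 : 0 < t by rewrite sqrtr_gt0.
have t2 : t ^+ 2 = 2 by rewrite sqr_sqrtr.
have scale (q e : R) : rescale F t (q, e) = t^-1 * F (q, 2 * e).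
  rewrite -(norm_pscale Fnorm) ?invr_ge0 ?ltW// /rescale /= -t2.
  by congr (F (_, _)); field; rewrite gt_eqF.
have eE : cf_err alpha b (fun=> 1) 1 = - w 0.
  by rewrite /cf_err /cf_num /cf_den /= /rcf_frac /=; ring.
move=> y yx; rewrite approx_vec_convergent; last exact: adm.
rewrite eE !scale ltr_pM2l ?invr_gt0// mulrN norm_Nr// /cf_den /=.
have [q1|qn1] := eqVneq (denq y) 1; last first.
  have q2 : 1 < denq y by have := denq_gt0 y; move: qn1; clear; lia.
  have {}q2 := @intr_lt_succ R _ _ q2.
  apply: (@lt_le_trans _ _ 2).
    have := norm_le_sum Fnorm Fsym 1 (2 * w 0).
    by rewrite normr1 ger0_norm; lra.
  apply: le_trans (norm_ge_l Fnorm Fsym _ _).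
  by apply: le_trans (ler_norm _); apply: le_trans q2.
set e := _ - _.
have e1 : 1 - w 0 <= `|e|.
  have pb : numq y - b 0 != 0.
    apply/eqP => pb; move: yx; rewrite /convergent /= -(divq_num_den y) q1 divr1.
    by rewrite (_ : numq y = b 0) ?eqxx//; move: pb; clear; lia.
  have -> : e = (numq y - b 0)%:~R - w 0.
    by rewrite /e q1 mulr1 intrB /rcf_frac /=; ring.
  have [pb0|pb0] := ltP (numq y - b 0) 0.
    by have := @intr_lt0 R _ pb0 => h; rewrite ler0_norm; lra.
  have {pb0}pb0 : 0 < numq y - b 0 by rewrite lt_neqAle eq_sym pb.
  by have := @intr_gt0 R _ pb0 => h; rewrite ger0_norm; lra.
rewrite q1; apply: (@lt_le_trans _ _ (F (1, 2 * (1 - w 0)))); last first.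
  by apply: norm_le => //; rewrite normrM [leRHS]normrM ler_wpM2l// ger0_norm; lra.
rewrite ltNge; apply/negP => le.
have h : F (1, 2 * (1 - w 0)) <= `|1| by apply: (norm_flat_r Fnorm Fsym _ _ le); lra.
have := norm_ge_r Fnorm Fsym 1 (2 * (1 - w 0)).
by rewrite normr1 in h; rewrite ger0_norm; lra.
Qed.

Lemma rcf_best_approximationS n : ~ shadow_area F (rcf_point n.+1) ->
  best_approximation F alpha (cv n.+1).
Proof.
move: n => k; set n := k.+1 => nS.
have u0 := rcf_frac_gt0 irr n; have u1 := rcf_frac_lt1 irr n.
have w0 := rcf_frac_gt0 irr n.+1; have w1 := rcf_frac_lt1 irr n.+1.
have Q0 : 0 < (Q n.+1)%:~R :> R by rewrite ltr0z rcf_den_gt0.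
have Qk : 0 < (Q n)%:~R :> R by rewrite ltr0z rcf_den_gt0.
have D0 : 0 < `|D n| by rewrite normr_gt0 rcf_err_neq0.
have /andP[_ v1] := rcf_point2_itv n.
have v0 : 0 < (rcf_point n).2 by rewrite divr_gt0.
have uV : w n * (w n)^-1 = 1 by rewrite mulfV// gt_eqF.
have wE := rcf_fracS alpha n.
have bu1 : (b n.+1)%:~R * w n < 1 by nra.
have bu2 : 1 < ((b n.+1)%:~R + 1) * w n by nra.
have [||||||t2 t20 tmin] :=
  @lattice_min_ex R F Fnorm Fsym (w n) (rcf_point n).2 (b n.+1).
- by rewrite v0.
- exact: rcf_digit_ge1.
- by rewrite u0.
- exact: bu1.
- exact: bu2.
- move=> b1 sh; apply: nS; split => //; last by rewrite ltW.
  by rewrite /= u1 andbT; rewrite b1 in bu2; lra.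
pose t := Num.sqrt (t2 * (Q n.+1)%:~R / `|D n|).
have t0 : 0 < t by rewrite sqrtr_gt0 divr_gt0// mulr_gt0.
have tE : t ^+ 2 * `|D n| / (Q n.+1)%:~R = t2.
  rewrite sqr_sqrtr; last by rewrite divr_ge0// mulr_ge0// ltW.
  by field; rewrite !gt_eqF.
have min (x y : int) : x != 0 -> rescale F t (approx_vec alpha (cv n)) <
    rescale F t ((x * Q n + y * Q n.+1)%:~R,
      (x * P n + y * P n.+1)%:~R - alpha * (x * Q n + y * Q n.+1)%:~R).
  move=> x0; rewrite approx_vec_cv !rescale_lattice// tE ltr_pM2l ?divr_gt0//.
  by rewrite mul0r add0r mul1r sub0r mulrN norm_Nr// tmin.
exists t.
  (* The minimum also beats the lattice vector (0, 1), of length t, whereas the convergent has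
     length at least 1 / t; hence t > 1. *)
  have [x [y [pE qE]]] := rcf_lattice n 1 0.
  have x0 : x != 0.
    apply/eqP => x0; move: pE qE; rewrite x0 !mul0r !add0r => pE /esym/eqP.
    rewrite mulf_eq0 [Q _ == _]gt_eqF ?rcf_den_gt0// orbF => /eqP y0.
    by rewrite y0 mul0r in pE.
  have := min x y x0; rewrite -pE -qE (approx_vec_convergent _ _ adm).
  rewrite /rescale /= !mulr0 subr0 mulr1 [F (0, _)]norm_0y// (gtr0_norm t0).
  have := norm_ge_l Fnorm Fsym (t^-1 * (Q n.+1)%:~R) (t * D n.+1).
  rewrite /= gtr0_norm ?mulr_gt0 ?invr_gt0// => h1 h2.
  have Q1 : 1 <= (Q n.+1)%:~R :> R by apply: intr_gt0; exact: rcf_den_gt0.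
  have tV : t * t^-1 = 1 by rewrite mulfV// gt_eqF.
  have tV0 : 0 < t^-1 by rewrite invr_gt0.
  rewrite ltNge; apply/negP => t1; nra.
move=> y yx; rewrite [approx_vec _ y]/approx_vec.
have [x [y' [pE qE]]] := rcf_lattice n (numq y) (denq y).
rewrite [X in ((X)%:~R, _)]qE [X in (_, _ - _ * X%:~R)]qE pE; apply: min.
apply/eqP => x0; move: pE qE; rewrite x0 !mul0r !add0r => pE qE.
move: yx; apply/negP/negPn/eqP.
rewrite convergentE; last exact: adm.
rewrite -(divq_num_den y) pE qE !intrM.
have y'0 : y' != 0 by apply/eqP => y'0; have := denq_neq0 y; rewrite qE y'0 mul0r eqxx.
have Qn0 : (Q n.+1) != 0 by rewrite gt_eqF// rcf_den_gt0.
by field; rewrite !intr_eq0 Qn0 y'0.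
Qed.

Lemma rcf_best_approximationP x : best_approximation F alpha x <->
  exists2 n, cv n = x & ~ shadow_area F (rcf_point n).
Proof.
split; first exact: best_approximation_rcf.
move=> [[|n] <-]; first exact: rcf_best_approximation0.
exact: rcf_best_approximationS.
Qed.

End BestApproximation.

(** * Singularization *)

Section Singularization.
Context (b : nat -> int) (s : pred nat).
Context (s_sep : forall n, s n -> ~~ s n.+1) (s_digit : forall n, s n -> b n.+1 = 1).
Context (b_ge1 : forall n, (0 < n)%N -> 1 <= b n).

Fixpoint kept (m : nat) : nat :=
  if m is m'.+1 then ((kept m').+1 + s (kept m'))%N else 0%N.

Definition sing2 j := (2 <= j)%N && s (j - 2)%N.

Definition sing_num m : int := b (kept m) + (s (kept m))%:R + (sing2 (kept m))%:R.

Definition sing_eps m : int := if sing2 (kept m) then -1 else 1.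

Lemma kept_lt m : (kept m < kept m.+1)%N.
Proof. by rewrite /= addSn ltnS leq_addr. Qed.

Lemma kept_ge m : (m <= kept m)%N.
Proof. by elim: m => // m IHm; apply: leq_ltn_trans IHm (kept_lt m). Qed.

Lemma keptP j : (exists m, kept m = j) <-> (j = 0%N \/ ~~ s j.-1).
Proof.
split.
  move=> [[|m] <-]; [by left|right].
  rewrite -[(kept m.+1).-1]/(kept m + s (kept m))%N; have [sm|sm] := boolP (s (kept m)).
    by rewrite addn1 s_sep.
  by rewrite addn0.
elim/ltn_ind: j => -[_ _|j IHj]; first by exists 0%N.
case=> // sj; case: j sj IHj => [|j] /= sj IHj.
  by exists 1%N; rewrite /= (negbTE sj).
have [sj'|sj'] := boolP (s j); last first.
  have [|m mE] := IHj j.+1 (ltnSn _); first by right.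
  by exists m.+1; rewrite /= mE (negbTE sj) addn0.
have [||m mE] := IHj j; first by rewrite ltnS leqnSn.
  case: j sj' {sj IHj} => [|j] sj; [by left|right => /=].
  by apply/negP => /s_sep; rewrite sj.
by exists m.+1; rewrite /= mE sj' addn1.
Qed.

Lemma sing2_kept m : sing2 (kept m.+1) = s (kept m).
Proof.
rewrite /sing2 /=; case: (boolP (s (kept m))) => [sm|sm].
  by rewrite addn1 /= subn2 /= sm.
rewrite addn0; have [km|] : kept m = 0%N \/ ~~ s (kept m).-1 by apply/keptP; exists m.
  by rewrite km.
case: (kept m) => [//|j] /= sj.
by rewrite subn2 /= (negbTE sj).
Qed.

(** A deleted digit equals 1, so its step of the recurrence is a plain sum and the skipped term can
    be eliminated. Numerators and denominators of the new expansion are thus regular ones at the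
    kept indices. *)
Lemma kept_rec (X : nat -> int) : (forall n, X n.+2 = b n.+1 * X n.+1 + X n) ->
  forall m, X (kept m.+2) = sing_num m.+1 * X (kept m.+1) + sing_eps m.+1 * X (kept m).
Proof.
move=> XSS m; rewrite /sing_num /sing_eps sing2_kept.
set k := kept m.+1.
have kE : k = ((kept m).+1 + s (kept m))%N by [].
have -> : X (kept m.+2) = (b k + (s k)%:R) * X k + X k.-1.
  rewrite -[kept m.+2]/((k.+1 + s k)%N).
  have [j jE] : exists j, k = j.+1 by exists (k.-1); rewrite kE addSn.
  rewrite jE /=; case: (boolP (s j.+1)) => sj.
    by rewrite addn1 XSS s_digit// mul1r XSS /=; ring.
  by rewrite addn0 XSS /=; ring.
rewrite {}kE; case: (boolP (s (kept m))) => sm /=.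
  by rewrite !addn1 (XSS (kept m)) (s_digit sm); ring.
by rewrite !addn0; ring.
Qed.

Lemma sing_num_cf m : cf_num sing_num sing_eps m = cf_num b (fun=> 1) (kept m) /\
  cf_num sing_num sing_eps m.+1 = cf_num b (fun=> 1) (kept m.+1).
Proof.
elim: m => [|m [IHm IHm1]].
  split=> //; rewrite /cf_num /= /sing_num /sing2 /=.
  by case: (boolP (s 0)) => s0; rewrite /= ?s_digit//; ring.
split=> //; rewrite cf_numSS IHm IHm1 -kept_rec// => n.
by rewrite cf_numSS mul1r.
Qed.

Lemma sing_den_cf m : cf_den sing_num sing_eps m = cf_den b (fun=> 1) (kept m) /\
  cf_den sing_num sing_eps m.+1 = cf_den b (fun=> 1) (kept m.+1).
Proof.
elim: m => [|m [IHm IHm1]].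
  split=> //; rewrite /cf_den /=.
  by case: (boolP (s 0)) => s0; rewrite /= ?s_digit//; ring.
split=> //; rewrite cf_denSS IHm IHm1 -kept_rec// => n.
by rewrite cf_denSS mul1r.
Qed.

Lemma sing_semi_regular : semi_regular sing_num sing_eps.
Proof.
have k0 m : (0 < m)%N -> (0 < kept m)%N by move=> m0; apply: leq_trans (kept_ge m).
have num_ge m : (0 < m)%N ->
    1 + (s (kept m))%:R + (sing2 (kept m))%:R <= sing_num m.
  by move=> m0; rewrite /sing_num !lerD2r b_ge1// k0.
split=> [m m0|m m0|m m0|N].
- by have := num_ge m m0; case: (s _); case: (sing2 _) => /=; lia.
- by rewrite /sing_eps; case: ifP; [right|left].
- have := num_ge m m0; rewrite /sing_eps sing2_kept.
  by case: (s _); case: (sing2 _) => /=; lia.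
(* The sum can be 1 only at a singularized index not preceded by a deletion; the next kept index
   then does follow a deletion. *)
- have key m : (0 < m)%N -> sing2 (kept m) || ~~ s (kept m) ->
      2 <= sing_num m + sing_eps m.+1.
    move=> m0; have := num_ge m m0; rewrite /sing_eps sing2_kept.
    by case: (s _); case: (sing2 _) => //=; lia.
  have [h|] := boolP (sing2 (kept N.+1) || ~~ s (kept N.+1)).
    by exists N.+1 => //; exact: key.
  rewrite negb_or negbK => /andP[_ sN]; exists N.+2 => //; apply: key => //.
  by rewrite sing2_kept sN.
Qed.

(** The shift comes from [cf_num] and [cf_den], whose index m + 1 belongs to the convergent m. By
    [keptP] the predecessors of the positive kept indices are exactly the indices not
    singularized. *)
Lemma sing_convergent m :
  convergent sing_num sing_eps m = convergent b (fun=> 1) (kept m.+1).-1.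
Proof.
have adm : cf_admissible b (fun=> 1).
  split=> n n0; [exact: lt_le_trans (b_ge1 n0)|by left|].
  by have := b_ge1 n0; lia.
have [n0 e0 ne _] := sing_semi_regular.
have adm' : cf_admissible sing_num sing_eps by split.
rewrite !convergentE// (sing_num_cf m).2 (sing_den_cf m).2.
by rewrite prednK// /= addSn.
Qed.

Lemma sing_converges (R : realType) (alpha : R) :
  cf_converges b (fun=> 1) alpha -> cf_converges sing_num sing_eps alpha.
Proof.
move=> cv; rewrite /cf_converges.
under eq_fun do rewrite sing_convergent.
apply: (@cvg_comp _ _ _ (fun m => (kept m.+1).-1)
  (fun n => ratr (convergent b (fun=> 1) n) : R) _ \oo) cv.
move=> A [N _ NA]; exists N => // m /= Nm; apply: NA => /=.
exact: leq_trans Nm (leq_trans (kept_ge m) (leq_addr _ _)).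
Qed.

End Singularization.

(** * The expansion of a given irrational number *)

Section Expansion.
Context {R : realType}.
Context (F : R * R -> R) (Fnorm : is_norm F) (Fsym : strongly_symmetric F).
Context (alpha : R) (irr : irrational alpha).
Local Notation b := (rcf_digit alpha).
Local Notation sing := (singularized (shadow_area F) alpha b).

Lemma singularizedP n : reflect (shadow_area F (rcf_point alpha n)) (sing n).
Proof.
apply: (iffP (asboolP _)); by rewrite rcf_uE// rcf_vE.
Qed.

Lemma sing_digit n : sing n -> b n.+1 = 1.
Proof. by move=> /singularizedP[/= /andP[w2 _] _ _]; exact: rcf_digit1. Qed.

Lemma sing_sep n : sing n -> ~~ sing n.+1.
Proof.
move=> sn; have b1 := sing_digit sn.
move: sn => /singularizedP[u12 v01 sh]; apply/negP => /singularizedP[/= u'12 _ sh'].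
move: u'12 sh'; rewrite /rcf_point rcf_fracS b1 => /andP[u'2 _].
have Q0 : 0 < (cf_den b (fun=> 1) n.+1)%:~R :> R by rewrite ltr0z rcf_den_gt0.
have -> : (cf_den b (fun=> 1) n.+1)%:~R / (cf_den b (fun=> 1) n.+2)%:~R =
    ((rcf_point alpha n).2 + 1)^-1 :> R.
  have Q1 := rcf_den_ge0 irr n; rewrite -(ler_int R) in Q1.
  rewrite rcf_denSS b1 mul1r intrD /=; field.
  by rewrite !gt_eqF//; apply: ltr_wpDl.
exact: (shadowed_not_consecutive Fnorm Fsym u12 v01 u'2 sh).
Qed.

Lemma sing_has_F_convergents :
  has_F_convergents F alpha (sing_num b sing) (sing_eps sing).
Proof.
have b1 := @rcf_digit_ge1 _ _ irr.
split.
- exact: (sing_semi_regular sing_sep).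
- exact: (sing_converges sing_sep sing_digit b1 (rcf_converges irr)).
- move=> x; rewrite (rcf_best_approximationP Fnorm Fsym irr); split.
    move=> [n <- nS].
    have [[|m] // mE] : exists m, kept sing m = n.+1.
      by apply/(keptP sing_sep); right; apply/singularizedP.
    by exists m; rewrite (sing_convergent sing_sep sing_digit b1) mE.
  move=> [m <-]; rewrite (sing_convergent sing_sep sing_digit b1).
  exists (kept sing m.+1).-1 => //.
  have [//|/singularizedP//] : kept sing m.+1 = 0%N \/ ~~ sing (kept sing m.+1).-1.
  by apply/(keptP sing_sep); exists m.+1.
Qed.

Lemma sing_is_F_continued_fraction :
  is_F_continued_fraction F alpha (sing_num b sing) (sing_eps sing).
Proof.
have hF := sing_has_F_convergents; split=> // a' eps' [reg' cv' best'].
have [reg cv best] := hF; apply: semi_regular_unique irr reg reg' cv cv' _ => x.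
by rewrite -best best'.
Qed.

Lemma sing_is_S_expansion :
  is_S_expansion (shadow_area F) alpha (sing_num b sing) (sing_eps sing).
Proof.
exists b; split; first exact: rcf_is_regular.
exists (kept sing); split=> //; [exact: kept_lt|exact: (keptP sing_sep)].
Qed.

End Expansion.

Theorem theorem7 (R : realType) (F : R * R -> R)
    (Fnorm : is_norm F) (Fsym : strongly_symmetric F) :
  exists S : set (R * R),
    singularization_area S /\
    forall alpha : R, irrational alpha ->
      exists a eps : nat -> int,
        is_F_continued_fraction F alpha a eps /\ is_S_expansion S alpha a eps.
Proof.
exists (shadow_area F); split; first exact: shadow_area_singularization.
move=> alpha irr; do 2!eexists; split; first exact: sing_is_F_continued_fraction.
exact: sing_is_S_expansion.
Qed.
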